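(* Fix a Higgs tensor $\xi$ on a $2$-dimensional torus $M$ (complex dimension $2$), and suppose that either $\mathrm{Re}(\xi)$, $\mathrm{Im}(\xi)$ are (positive or negative) semidefinite, or $\det(\xi)=0$. Let $u_t=(1-t)u_0+t\,u_1$, $t\in[0,1]$, be a linear path between symplectic potentials $u_0$, $u_1$, such that $\|\xi\|^2_{u_i}<1$ for $i=0,1$. Then the HK-energy $\widehat{\mathcal{F}}(u_t,\xi)$ is a well-defined and strictly convex function of $t\in[0,1]$.
   Context: The abelian surface is $M=\mathbb{C}^2/(\mathbb{Z}^2+\mathrm{i}\mathbb{Z}^2)$, and $\mathbb{T}=\mathbb{R}^2/\mathbb{Z}^2$ has coordinates $\boldsymbol y$ and Lebesgue measure $\mathrm{d}\mu$. A symplectic potential is $u(\boldsymbol y)=\frac12|\boldsymbol y|^2+(\text{smooth periodic function})$ with positive definite Hessian $G=D^2u$. A Higgs tensor is a smooth function $\xi$ on $\mathbb{T}$ with values in complex symmetric $2\times2$ matrices. $\|\xi\|^2_u=\mathrm{Tr}(\xi\,D^2u\,\bar\xi\,D^2u)$ (a function on $\mathbb{T}$; the inequality $<1$ is required at every point). Let $\delta^\pm$ be the (real, non-negative) eigenvalues of $\xi\,D^2u\,\bar\xi\,D^2u$. The periodic HK-energy, defined when $\delta^\pm<1$, is $$\widehat{\mathcal{F}}(u,\xi)=-\frac12\int_{\mathbb{T}}\log\det(D^2u)\,\mathrm{d}\mu+\frac12\int_{\mathbb{T}}\sum_{\pm}\Big(1-\sqrt{1-\delta^\pm}+\log\tfrac{1+\sqrt{1-\delta^\pm}}{2}\Big)\mathrm{d}\mu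 .$$
   Formalization: Strict convexity is asserted only when u_1 - u_0 is not constant; if u_1 = u_0 + c the Hessian, hence the HK-energy, does not depend on t, so strict convexity fails. Well-definedness is proved in all cases. *)

(* Defs.v *)
(* MathComp-Analysis *)
From mathcomp Require Import all_boot all_order all_algebra.
From mathcomp Require Import complex.
From mathcomp Require Import all_classical all_reals all_analysis.
Set Implicit Arguments.
Unset Strict Implicit.
Unset Printing Implicit Defensive.
Import Order.TTheory GRing.Theory Num.Theory.
Import numFieldNormedType.Exports.
Local Open Scope classical_set_scope.
Local Open Scope ring_scope.

(* Functions on the torus R^2/Z^2 are Z^2-periodic functions on R * R, and
   integrals over the torus are integrals over the unit square. *)

Definition basis_vec (R : realType) (i : 'I_2) : (R * R)%type :=
  ((i == 0)%:R, (i == 1)%:R).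

Definition Z2_periodic (R : realType) (V : zmodType) (f : R * R -> V) : Prop :=
  forall i : 'I_2, periodic f (basis_vec R i).

Definition partial (R : realType) (i : 'I_2) (f : R * R -> R) : R * R -> R :=
  fun y => 'D_(basis_vec R i) f y.

(* C^infty: every iterated partial derivative is Frechet differentiable. *)
Definition smooth (R : realType) (f : R * R -> R) : Prop :=
  forall (s : seq 'I_2) (y : R * R),
    differentiable (foldr (@partial R) f s) y.

Definition hessian (R : realType) (u : R * R -> R) (y : R * R) : 'M[R]_2 :=
  \matrix_(i, j) partial i (partial j u) y.

Definition posdef (R : realType) (A : 'M[R]_2) : Prop :=
  A^T = A /\ forall v : 'rV[R]_2, v != 0 -> 0 < (v *m A *m v^T) 0 0.

Definition semidefinite (R : realType) (A : 'M[R]_2) : Prop :=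
  (forall v : 'rV[R]_2, 0 <= (v *m A *m v^T) 0 0) \/
  (forall v : 'rV[R]_2, (v *m A *m v^T) 0 0 <= 0).

Definition symplectic_potential (R : realType) (u : R * R -> R) : Prop :=
  (exists phi : R * R -> R, [/\ smooth phi, Z2_periodic phi &
     forall y, u y = 2^-1 * (y.1 ^+ 2 + y.2 ^+ 2) + phi y]) /\
  forall y, posdef (hessian u y).

Definition mxRe (R : realType) (A : 'M[R[i]]_2) : 'M[R]_2 :=
  map_mx (@complex.Re R) A.

Definition mxIm (R : realType) (A : 'M[R[i]]_2) : 'M[R]_2 :=
  map_mx (@complex.Im R) A.

Definition higgs_tensor (R : realType) (xi : R * R -> 'M[R[i]]_2) : Prop :=
  [/\ Z2_periodic xi,
      forall y, (xi y)^T = xi y &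
      forall i j : 'I_2, smooth (fun y => mxRe (xi y) i j) /\
                         smooth (fun y => mxIm (xi y) i j)].

(* xi D^2u conj(xi) D^2u *)
Definition higgs_mx (R : realType) (u : R * R -> R)
    (xi : R * R -> 'M[R[i]]_2) (y : R * R) : 'M[R[i]]_2 :=
  let G := map_mx (@real_complex R) (hessian u y) in
  xi y *m G *m map_mx (@conjc R) (xi y) *m G.

(* ||xi||^2_u; in the order of R[i], an inequality [z < 1] includes the fact
   that [z] is real. *)
Definition higgs_norm2 (R : realType) (u : R * R -> R)
    (xi : R * R -> 'M[R[i]]_2) (y : R * R) : R[i] :=
  \tr (higgs_mx u xi y).

(* The roots of the characteristic polynomial, with multiplicity. *)
Definition eigenvals (R : realType) (A : 'M[R[i]]_2) : seq R[i] :=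
  sval (closed_field_poly_normal (char_poly A)).

Definition unit_square (R : realType) : set (R * R) := `[0, 1] `*` `[0, 1].
Arguments unit_square R : clear implicits.

Definition mu2 (R : realType) :=
  (@lebesgue_measure R \x @lebesgue_measure R)%E.
Arguments mu2 R : clear implicits.

Definition logdet_density (R : realType) (u : R * R -> R) (y : R * R) : R :=
  ln (\det (hessian u y)).

Definition hk_density (R : realType) (u : R * R -> R)
    (xi : R * R -> 'M[R[i]]_2) (y : R * R) : R :=
  \sum_(delta <- eigenvals (higgs_mx u xi y))
    (let s := Num.sqrt (1 - complex.Re delta) in 1 - s + ln ((1 + s) / 2)).

(* The eigenvalues are real, in [0, 1) (order of R[i]), and both integrands
   of the energy are Lebesgue integrable. *)
Definition hk_energy_defined (R : realType) (u : R * R -> R)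
    (xi : R * R -> 'M[R[i]]_2) : Prop :=
  [/\ forall y, {in eigenvals (higgs_mx u xi y), forall delta, 0 <= delta < 1},
      (mu2 R).-integrable (unit_square R) (EFin \o logdet_density u) &
      (mu2 R).-integrable (unit_square R) (EFin \o hk_density u xi)].

Definition hk_energy (R : realType) (u : R * R -> R)
    (xi : R * R -> 'M[R[i]]_2) : R :=
  - 2^-1 * \int[mu2 R]_(y in unit_square R) logdet_density u y
  + 2^-1 * \int[mu2 R]_(y in unit_square R) hk_density u xi y.

Definition strictly_convex_on (R : realType) (D : set R) (f : R -> R) : Prop :=
  forall s t c : R, D s -> D t -> s != t -> 0 < c < 1 ->
    f ((1 - c) * s + c * t) < (1 - c) * f s + c * f t.

Definition linear_path (R : realType) (u0 u1 : R * R -> R) (t : R)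
    : R * R -> R :=
  fun y => (1 - t) * u0 y + t * u1 y.

(* Main.v *)
(* Write G = D^2 u, T = Tr(xi G xibar G) and D = |det xi|^2 (det G)^2 for the
   sum and the product of the eigenvalues, P = sqrt(1 - T + D) and
   S = sqrt(2 - T + 2 P) for the product and the sum of the numbers
   sqrt(1 - delta).  The second integrand is then
   Phi(T, D) = 2 - S + ln((1 + S + P) / 4), a jointly convex function of (T, D)
   with gradient (1/(2S), - 1/(2 S (1 + S + P))).  The hypothesis on xi makes
   the quadratic form T positive semidefinite on symmetric matrices G, so T is
   convex along a linear path and ||xi||^2 < 1 propagates.  Replacing Phi by its
   tangent plane at an intermediate point reduces convexity of Phi - ln det G to
   that of - b (det G)^2 - ln det G, which is strict where b (det G)^2 <= 1/16;
   T < 1 and 4 D <= T^2 give this bound.  Strictness of the integral comes from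
   the fact that two periodic perturbations with the same Hessian everywhere
   differ by a constant. *)
Require Import Defs.
From mathcomp Require Import all_boot all_order all_algebra.
From mathcomp Require Import complex.
From mathcomp Require Import all_classical all_reals all_analysis.
From mathcomp Require Import ring lra.
Set Implicit Arguments.
Unset Strict Implicit.
Unset Printing Implicit Defensive.
Import Order.TTheory GRing.Theory Num.Theory.
Import numFieldNormedType.Exports.
Local Open Scope classical_set_scope.
Local Open Scope ring_scope.

(** * Pointwise strict convexity *)

Lemma nondecreasing_of_is_derive (R : realType) (f df : R -> R) (a b : R) :
  a <= b ->
  (forall x, a <= x <= b -> is_derive x 1 f (df x)) ->
  (forall x, a <= x <= b -> 0 <= df x) -> f a <= f b.
Proof.
move=> ab fd df0.
have itvW (x : R) : x \in `]a, b[ -> a <= x <= b.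
  by rewrite in_itv /= => /andP[/ltW -> /ltW ->].
apply: (@ger0_derive1_ndecr R f a b) => //.
- by move=> x /itvW/fd.
- by move=> x /itvW xab; rewrite derive1E (@derive_val _ _ _ _ _ _ _ (fd x xab)) df0.
- apply: derivable_within_continuous => x; rewrite in_itv /= => xab.
  by have := fd x xab.
Qed.

(** The right side minus the left vanishes at 1 and has derivative (x - 1)^2 / x. *)
Lemma ln_ge_taylor2 (R : realType) (z : R) : 1 <= z ->
  z - 1 - (z - 1) ^+ 2 / 2 <= ln z.
Proof.
move=> z1.
suff : ln 1 - (1 - 1 - (1 - 1) ^+ 2 / 2) <= ln z - (z - 1 - (z - 1) ^+ 2 / 2).
  by rewrite ln1; lra.
pose f (x : R) : R := ln x - (x - 1 - (x - 1) ^+ 2 / 2).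
apply: (@nondecreasing_of_is_derive R f (fun x => (x - 1) ^+ 2 / x) 1 z z1).
- move=> x /andP[x1 _]; have x0 : 0 < x by lra.
  have dl := is_derive1_ln x0.
  rewrite /f; apply: is_derive_eq.
  by rewrite /GRing.scale /= /GRing.scale /=; field; rewrite gt_eqF.
- by move=> x /andP[x1 _]; rewrite divr_ge0 ?sqr_ge0//; lra.
Qed.

(** The left side minus the right increases to 0 at 1, its derivative being (x - 1)^2 / (2 x^2). *)
Lemma ln_ge_half_subV (R : realType) (y : R) : 0 < y -> y <= 1 ->
  (y - y^-1) / 2 <= ln y.
Proof.
move=> y0 y1.
suff : (y - y^-1) / 2 - ln y <= (1 - 1^-1) / 2 - ln 1.
  by rewrite ln1 invr1; lra.
pose f (x : R) : R := (x - x^-1) / 2 - ln x.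
apply: (@nondecreasing_of_is_derive R f
  (fun x => (x - 1) ^+ 2 / (2 * x ^+ 2)) y 1 y1).
- move=> x /andP[x1 _]; have x0 : 0 < x by lra.
  have dl := is_derive1_ln x0.
  have xn0 : x != 0 by rewrite gt_eqF.
  have dV := @is_deriveV R id x 1 1 xn0 _.
  rewrite /f; apply: is_derive_eq.
  by rewrite /GRing.scale /= /GRing.scale /=; field.
- move=> x /andP[x1 _]; rewrite divr_ge0 ?sqr_ge0// mulr_ge0 ?sqr_ge0//.
Qed.

(* The right-hand side is [2 S0] times the gap between Phi(T1, D1) and the
   tangent plane of Phi at (T0, D0), in the coordinates (S, P). *)
Lemma hk_tangent_core (R : realType) (S0 P0 S1 P1 z : R) :
  0 < S0 -> 0 <= P0 -> 0 < S1 -> 0 <= P1 ->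
  z = (1 + S1 + P1) / (1 + S0 + P0) ->
  0 <= (S1 - S0 - (z - 1)) ^+ 2 + (z - 1) ^+ 2 * (S0 + P0)
       + 2 * S0 * (ln z - (z - 1)).
Proof.
move=> S0p P0p S1p P1p zdef.
have B0p : 0 < 1 + S0 + P0 by lra.
have B1p : 0 < 1 + S1 + P1 by lra.
have zp : 0 < z by rewrite zdef divr_gt0.
have zB : z * (1 + S0 + P0) = 1 + S1 + P1 by rewrite zdef mulfVK ?gt_eqF.
have bp : 0 < S0 + P0 by lra.
have [z1|z1] := leP 1 z.
  have h := ln_ge_taylor2 z1.
  set L := ln z in h *.
  have : 2 * S0 * (- ((z - 1) ^+ 2 / 2)) <= 2 * S0 * (L - (z - 1)).
    by rewrite ler_pM2l; [lra|lra].
  have := mulr_ge0 (sqr_ge0 (z - 1)) P0p.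
  have := sqr_ge0 (S1 - S0 - (z - 1)).
  by lra.
(* For z < 1, bounding [ln z] by (z - 1/z) / 2 leaves a square plus (z - 1)^2 / z times z (S0 + P0)
   - S0; the sign of this factor decides whether a single bound suffices. *)
have [zs|zs] := leP S0 (z * (S0 + P0)).
  have h := ln_ge_half_subV zp (ltW z1).
  set L := ln z in h *.
  have h2 : 2 * S0 * ((z - z^-1) / 2 - (z - 1)) <= 2 * S0 * (L - (z - 1)).
    by rewrite ler_pM2l; [lra|lra].
  have -> : (S1 - S0 - (z - 1)) ^+ 2 + (z - 1) ^+ 2 * (S0 + P0)
       + 2 * S0 * (L - (z - 1)) =
     (S1 - S0 - (z - 1)) ^+ 2 + (z - 1) ^+ 2 / z * (z * (S0 + P0) - S0)
     + (2 * S0 * (L - (z - 1)) - 2 * S0 * ((z - z^-1) / 2 - (z - 1))).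
    by field; rewrite gt_eqF.
  rewrite addr_ge0 ?subr_ge0// addr_ge0 ?sqr_ge0// mulr_ge0 ?subr_ge0//.
  by rewrite divr_ge0 ?sqr_ge0// ltW.
(* [zz] is the value of z at which that factor vanishes. Since z < [zz] <= 1, the logarithmic bound
   is applied to z / [zz] and to [zz] separately, which is sharper than applying it to z. *)
pose zz := S0 / (S0 + P0).
have zz0 : 0 < zz by rewrite divr_gt0.
have zz1 : zz <= 1 by rewrite ler_pdivrMr // mul1r; lra.
pose y := z / zz.
have y0 : 0 < y by rewrite divr_gt0.
have y1 : y <= 1.
  by rewrite ler_pdivrMr // mul1r /zz ler_pdivlMr // ltW.
have zE : z = y * zz by rewrite /y mulfVK ?gt_eqF.
have bE : S0 + P0 = S0 / zz by rewrite /zz; field; rewrite !gt_eqF.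
have hy := ln_ge_half_subV y0 y1.
have hz := ln_ge_half_subV zz0 zz1.
have lnE : ln z = ln y + ln zz by rewrite zE lnM ?posrE.
have {hy hz} h : (y - y^-1) / 2 + (zz - zz^-1) / 2 <= ln z by lra.
move: {lnE} (ln z) h => L h.
have h2 : 2 * S0 * ((y - y^-1) / 2 + (zz - zz^-1) / 2 - (z - 1))
   <= 2 * S0 * (L - (z - 1)).
  by rewrite ler_pM2l; [lra|lra].
apply: (le_trans _ (lerD (lexx _) h2)).
have g0 : 0 <= S0 * (1 - y) by rewrite mulr_ge0 ?subr_ge0// ltW.
(* [0 <= P1] forces [S1 - S0 - (z - 1)] below [- S0 (1 - y)]. *)
have e1 : S1 - S0 - (z - 1) <= - (S0 * (1 - y)).
  have : z * (S0 + P0) = y * S0 by rewrite zE bE; field; rewrite gt_eqF.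
  by lra.
have e2 : (S0 * (1 - y)) ^+ 2 <= (S1 - S0 - (z - 1)) ^+ 2.
  rewrite -[leRHS]sqrrN ler_pXn2r ?nnegrE//; lra.
have e3 : 1 <= y * (S0 + zz).
  have zz_le : zz <= y * (S0 + zz) * zz.
    have -> : y * (S0 + zz) * zz = z * (1 + S0 + P0) * zz.
      rewrite zE; have -> : 1 + S0 + P0 = 1 + S0 / zz by lra.
      by field; rewrite gt_eqF.
    by rewrite zB; apply: ler_peMl; lra.
  by rewrite -(ler_pM2r zz0) mul1r.
have e4 : 0 <= S0 * (1 - y) ^+ 2 * (S0 + zz - y^-1).
  rewrite mulr_ge0 ?(mulr_ge0 _ (sqr_ge0 _)) ?(ltW S0p)// subr_ge0.
  by rewrite -[leLHS]mul1r ler_pdivrMr // mulrC.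
have : (S0 * (1 - y)) ^+ 2 + (z - 1) ^+ 2 * (S0 + P0)
   + 2 * S0 * ((y - y^-1) / 2 + (zz - zz^-1) / 2 - (z - 1)) =
   S0 * (1 - y) ^+ 2 * (S0 + zz - y^-1).
  by rewrite zE bE; field; rewrite !gt_eqF.
by lra.
Qed.

Definition hkP (R : realType) (T D : R) : R := Num.sqrt (1 - T + D).

Definition hkS (R : realType) (T D : R) : R := Num.sqrt (2 - T + 2 * hkP T D).

Definition hkPhi (R : realType) (T D : R) : R :=
  2 - hkS T D + ln ((1 + hkS T D + hkP T D) / 4).

Lemma hkP_sqr (R : realType) (T D : R) : T < 1 -> 0 <= D ->
  hkP T D ^+ 2 = 1 - T + D.
Proof. by move=> T1 D0; rewrite sqr_sqrtr//; lra. Qed.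

Lemma hkP_ge0 (R : realType) (T D : R) : 0 <= hkP T D.
Proof. exact: sqrtr_ge0. Qed.

Lemma hkS_sqr (R : realType) (T D : R) : T < 1 ->
  hkS T D ^+ 2 = 2 - T + 2 * hkP T D.
Proof. by move=> T1; have P0 := hkP_ge0 T D; rewrite sqr_sqrtr//; lra. Qed.

Lemma hkS_gt1 (R : realType) (T D : R) : T < 1 -> 1 < hkS T D.
Proof.
move=> T1; rewrite -(@ltr_pXn2r _ 2) ?nnegrE ?sqrtr_ge0//.
by rewrite hkS_sqr// expr1n; have := hkP_ge0 T D; lra.
Qed.

Lemma hkPhi_tangent (R : realType) (T0 D0 T1 D1 : R) :
  T0 < 1 -> 0 <= D0 -> T1 < 1 -> 0 <= D1 ->
  let B0 := 1 + hkS T0 D0 + hkP T0 D0 in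
  hkPhi T0 D0 + (T1 - T0) / (2 * hkS T0 D0)
    - (D1 - D0) / (2 * hkS T0 D0 * B0) <= hkPhi T1 D1.
Proof.
move=> T0lt D0ge T1lt D1ge /=; rewrite /hkPhi.
have := hkS_gt1 D0 T0lt; have := hkS_gt1 D1 T1lt.
have := hkP_ge0 T0 D0; have := hkP_ge0 T1 D1.
have := hkP_sqr T0lt D0ge; have := hkP_sqr T1lt D1ge.
have := hkS_sqr D0 T0lt; have := hkS_sqr D1 T1lt.
move: (hkS T0 D0) (hkS T1 D1) (hkP T0 D0) (hkP T1 D1) => S0 S1 P0 P1.
move=> S1E S0E P1E P0E P1ge P0ge S1gt S0gt.
have B0p : 0 < 1 + S0 + P0 by lra.
have B1p : 0 < 1 + S1 + P1 by lra.
have S0p : 0 < S0 by lra.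
have := @hk_tangent_core R S0 P0 S1 P1 _ S0p P0ge _ P1ge erefl.
set z := (1 + S1 + P1) / (1 + S0 + P0).
have -> : (1 + S1 + P1) / 4 = z * ((1 + S0 + P0) / 4).
  by rewrite mulrA mulfVK ?gt_eqF.
rewrite (@lnM _ z) ?posrE ?divr_gt0//.
set L0 := ln ((1 + S0 + P0) / 4); set L := ln z.
(* The square roots disappear once (S, P) serve as coordinates: T and D are polynomials in them. *)
have T0E : T0 = 2 + 2 * P0 - S0 ^+ 2 by lra.
have T1E : T1 = 2 + 2 * P1 - S1 ^+ 2 by lra.
have D0E : D0 = P0 ^+ 2 - 1 + T0 by lra.
have D1E : D1 = P1 ^+ 2 - 1 + T1 by lra.
rewrite D0E D1E T0E T1E => /(_ _)/wrap[]; first lra.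
move=> h.
rewrite -subr_ge0 -(pmulr_rge0 _ (_ : 0 < 2 * S0)); last by lra.
rewrite (le_trans h)// le_eqVlt; apply/orP; left; apply/eqP.
by rewrite /z; field; rewrite !gt_eqF.
Qed.

(* Used with x = det G' / det G, y = Tr(G^-1 G') / 2, so that x <= y ^+ 2 with
   equality iff G' is a multiple of G; y is affine in G'. *)
Lemma ln_quad_tangent (R : realType) (e x y : R) :
  0 <= e <= 16^-1 -> 0 < x -> e * x ^+ 2 <= 16^-1 -> 0 < y -> x <= y ^+ 2 ->
  (x != y ^+ 2) || (y != 1) ->
  - (2 + 4 * e) * (y - 1) < - ln x - e * (x ^+ 2 - 1).
Proof.
move=> /andP[e0 e1] x0 ex y0 xy ne.
(* With n the fourth root of x, the estimate ln x <= 4 (n - 1) is tangent at 1 and leaves a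
   polynomial inequality in n and y. *)
pose m := Num.sqrt x; pose n := Num.sqrt m.
have m0 : 0 < m by rewrite sqrtr_gt0.
have n0 : 0 < n by rewrite sqrtr_gt0.
have mE : m = n ^+ 2 by rewrite sqr_sqrtr// ltW.
have xE : x = m ^+ 2 by rewrite sqr_sqrtr// ltW.
have my : m <= y by rewrite -(@ler_pXn2r _ 2) ?nnegrE ?(ltW m0) ?(ltW y0)// -xE.
have lnx : ln x <= 4 * (n - 1).
  have -> : ln x = 4 * ln n.
    by rewrite xE mE -exprM lnXn// mulr_natl.
  have := @le_ln1Dx R (n - 1); rewrite addrCA subrr addr0.
  by move=> /(_ _)/wrap[]; lra.
(* This factor multiplies (1 - n)^2 and competes with a coefficient 2, so the bound 3/2 keeps a
   margin of 1/2. The polynomial is at most 24 for n <= 1 and at most 24 x^2 for n >= 1, which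
   explains the two hypotheses with 1/16. *)
have key : e * ((1 + n) ^+ 2 * (m ^+ 2 + 2 * m + 3)) <= 3 / 2.
  have [n1|n1] := leP n 1.
    have m1 : m <= 1 by rewrite mE expr_le1// ltW.
    have m21 : m ^+ 2 <= 1 by rewrite expr_le1// ltW.
    have h1 : (1 + n) ^+ 2 * (m ^+ 2 + 2 * m + 3) <= 4 * 6.
      apply: ler_pM; rewrite ?sqr_ge0//; [|nra|lra].
      by have := sqr_ge0 m; lra.
    have h2 := ler_pM e0 _ e1 h1.
    rewrite (le_trans (h2 _))//; last lra.
    by rewrite mulr_ge0 ?sqr_ge0//; have := sqr_ge0 m; lra.
  have m1 : 1 <= m by rewrite mE -[leLHS](expr1n _ 2) ler_pXn2r ?nnegrE//; lra.
  have mm : m <= m ^+ 2 by rewrite expr2 ler_peMl// ltW.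
  have h1 : (1 + n) ^+ 2 * (m ^+ 2 + 2 * m + 3) <= (4 * m ^+ 2) * (6 * m ^+ 2).
    apply: ler_pM; rewrite ?sqr_ge0//; [|rewrite mE in mm *; nra|lra].
    by have := sqr_ge0 m; lra.
  have := ler_wpM2l e0 h1; rewrite xE in ex.
  by lra.
have diff : - ln x - e * (x ^+ 2 - 1) + (2 + 4 * e) * (y - 1) >=
   2^-1 * (1 - n) ^+ 2 + 2 * (y - m).
  have h3 : 0 <= (4 * e) * (y - m) by rewrite !mulr_ge0 ?subr_ge0//.
  have := mulr_ge0 (sqr_ge0 (1 - n)) (_ : 0 <= 3 / 2 - e * ((1 + n) ^+ 2 * (m ^+ 2 + 2 * m + 3))).
  rewrite subr_ge0 => /(_ key) h4.
  have : (2 + 4 * e) * (y - 1) - 4 * (n - 1) - e * (x ^+ 2 - 1)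
    - (2^-1 * (1 - n) ^+ 2 + 2 * (y - m)) = 4 * e * (y - m) +
     (1 - n) ^+ 2 * (3 / 2 - e * ((1 + n) ^+ 2 * (m ^+ 2 + 2 * m + 3))).
    by rewrite xE mE; field.
  by lra.
have : 0 < 2^-1 * (1 - n) ^+ 2 + 2 * (y - m).
  have n1ge := sqr_ge0 (1 - n).
  have [ym|ym] := eqVneq y m.
    have : n != 1.
      move: ne; rewrite ym xE eqxx /=; apply: contraNneq => n1.
      by rewrite mE n1 expr1n.
    rewrite ym subrr mulr0 addr0 => n1; rewrite mulr_gt0// lt0r n1ge andbT.
    by rewrite sqrf_eq0 subr_eq0 eq_sym.
  have : 0 < y - m by rewrite subr_gt0 lt_neqAle eq_sym ym.
  by lra.
by lra.
Qed.

(** * Mixed discriminants of positive definite matrices (g h; h k), and strict convexity in their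
    entries *)

Section PositiveTriples.
Variable R : realType.
Implicit Types g h k : R.

(* Up to the factor g^2, the discriminant of det(G' - s G) as a polynomial in s,
   computed after subtracting from G' the multiple of G with the same corner. *)
Lemma mixed_disc_identity g h k g' h' k' :
  g ^+ 2 * ((g * k' + g' * k - 2 * h * h') ^+ 2
     - 4 * ((g * k - h ^+ 2) * (g' * k' - h' ^+ 2))) =
  (g * (g * k' - g' * k) - 2 * h * (g * h' - g' * h)) ^+ 2
    + 4 * (g * k - h ^+ 2) * (g * h' - g' * h) ^+ 2.
Proof. by ring. Qed.

(** Arithmetic-geometric mean inequality for the eigenvalues of G^-1 G', whose sum is the mixed term
    divided by det G. *)
Lemma mixed_disc_le g h k g' h' k' : 0 < g -> 0 < g * k - h ^+ 2 ->
  4 * ((g * k - h ^+ 2) * (g' * k' - h' ^+ 2)) <=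
    (g * k' + g' * k - 2 * h * h') ^+ 2.
Proof.
move=> g0 q0; rewrite -subr_ge0 -(pmulr_rge0 _ (exprn_gt0 2 g0)).
by rewrite mixed_disc_identity addr_ge0 ?sqr_ge0// mulr_ge0 ?sqr_ge0//; lra.
Qed.

Lemma mixed_disc_gt0 g h k g' h' k' : 0 < g -> 0 < g' ->
  0 < g * k - h ^+ 2 -> 0 < g' * k' - h' ^+ 2 ->
  0 < g * k' + g' * k - 2 * h * h'.
Proof.
move=> g0 g0' q0 q0'; rewrite -(pmulr_rgt0 _ (mulr_gt0 g0 g0')).
have -> : g * g' * (g * k' + g' * k - 2 * h * h') =
  g ^+ 2 * (g' * k' - h' ^+ 2) + g' ^+ 2 * (g * k - h ^+ 2)
   + (g * h' - g' * h) ^+ 2 by ring.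
by rewrite ltr_wpDr ?sqr_ge0// addr_gt0// mulr_gt0// exprn_gt0.
Qed.

(** A vanishing discriminant makes G' a multiple of G; the normalisation Tr(G^-1 G') = 2 makes the
    factor 1. *)
Lemma mixed_disc_rigid g h k g' h' k' : 0 < g -> 0 < g * k - h ^+ 2 ->
  4 * ((g * k - h ^+ 2) * (g' * k' - h' ^+ 2)) =
    (g * k' + g' * k - 2 * h * h') ^+ 2 ->
  g * k' + g' * k - 2 * h * h' = 2 * (g * k - h ^+ 2) ->
  (g', h', k') = (g, h, k).
Proof.
move=> g0 q0 dE mE.
have := mixed_disc_identity g h k g' h' k'.
rewrite dE subrr mulr0 => /esym/eqP.
rewrite paddr_eq0 ?sqr_ge0//; last by rewrite mulr_ge0 ?sqr_ge0//; lra.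
rewrite sqrf_eq0 => /andP[+ he4].
have {he4} he : g * h' - g' * h = 0.
  apply/eqP; rewrite -sqrf_eq0; move: he4.
  by rewrite mulf_eq0 (gt_eqF (_ : 0 < 4 * _)) ?mulr_gt0.
rewrite he mulr0 subr0 mulf_eq0 (gt_eqF g0) /= => /eqP ke.
have gn0 : g != 0 by rewrite gt_eqF.
have hE : h' = g' * h / g by apply: (mulfI gn0); rewrite [RHS]mulrC mulfVK//; lra.
have kE : k' = g' * k / g by apply: (mulfI gn0); rewrite [RHS]mulrC mulfVK//; lra.
have : g' * (g * k - h ^+ 2) = g * (g * k - h ^+ 2).
  have : 2 * (g' * (g * k - h ^+ 2)) = g * (g * k' + g' * k - 2 * h * h').
    by rewrite hE kE; field.
  by rewrite mE; lra.
move=> /(mulIf (lt0r_neq0 q0)) gE.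
have divK t : g * t / g = t by rewrite mulrAC divff ?mul1r.
by rewrite hE kE gE !divK.
Qed.

(** Each endpoint lies strictly above an expression affine in (T, G) and exact at the intermediate
    matrix; averaging the two inequalities gives the claim. The T's are free numbers, so convexity
    of the trace enters only as an inequality. *)
Lemma hk_triple_convex (c kappa T T0 T1 g0 h0 k0 g1 h1 k1 g h k : R) :
  0 < c < 1 -> 0 <= kappa ->
  g = (1 - c) * g0 + c * g1 -> h = (1 - c) * h0 + c * h1 ->
  k = (1 - c) * k0 + c * k1 ->
  0 < g0 -> 0 < g0 * k0 - h0 ^+ 2 -> 0 < g1 -> 0 < g1 * k1 - h1 ^+ 2 ->
  0 < g -> 0 < g * k - h ^+ 2 ->
  0 <= T0 < 1 -> 0 <= T1 < 1 -> 0 <= T < 1 -> T <= (1 - c) * T0 + c * T1 ->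
  4 * (kappa * (g0 * k0 - h0 ^+ 2) ^+ 2) <= T0 ^+ 2 ->
  4 * (kappa * (g1 * k1 - h1 ^+ 2) ^+ 2) <= T1 ^+ 2 ->
  4 * (kappa * (g * k - h ^+ 2) ^+ 2) <= T ^+ 2 ->
  (g0, h0, k0) != (g1, h1, k1) ->
  hkPhi T (kappa * (g * k - h ^+ 2) ^+ 2) - ln (g * k - h ^+ 2) <
  (1 - c) * (hkPhi T0 (kappa * (g0 * k0 - h0 ^+ 2) ^+ 2)
             - ln (g0 * k0 - h0 ^+ 2))
  + c * (hkPhi T1 (kappa * (g1 * k1 - h1 ^+ 2) ^+ 2)
         - ln (g1 * k1 - h1 ^+ 2)).
Proof.
move=> /andP[c0 c1] kap gE hE kE g0p q0p g1p q1p gp qp.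
move=> /andP[T00 T01] /andP[T10 T11] /andP[T0p T1p] Tle D0le D1le Dle ne.
set q := g * k - h ^+ 2 in qp Dle *.
set D := kappa * q ^+ 2 in Dle *.
have D0 : 0 <= D by rewrite mulr_ge0// sqr_ge0.
have Ssqr := hkS_gt1 D T1p.
have P0 := hkP_ge0 T D.
set S := hkS T D in Ssqr.
set P := hkP T D in P0.
(* The slope of Phi in D is - 1 / M. Since S > 1, [M] is at least 4, and D <= 1/4 follows from T < 1
   and 4 D <= T^2; hence D / M <= 1/16, the threshold of [ln_quad_tangent], at all three
   matrices. *)
pose M := (2 * S * (1 + S + P)).
have M4 : 4 <= M by rewrite /M; nra.
have M0 : 0 < M by lra.
have D14 (t d : R) : 0 <= t < 1 -> 4 * d <= t ^+ 2 -> d <= 4^-1.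
  by move=> /andP[t0 t1] h4; have : t ^+ 2 <= 1 by [rewrite expr_le1 ?(ltW t1)]; lra.
pose e := D / M.
have e0 : 0 <= e by rewrite divr_ge0// ltW.
have bound (t d : R) : 0 <= t < 1 -> 0 <= d -> 4 * d <= t ^+ 2 -> d / M <= 16^-1.
  by move=> t01 d0 /(D14 _ _ t01) d4; rewrite ler_pdivrMr//; lra.
have e1 : e <= 16^-1 by apply: (bound T); rewrite ?T0p.
have tang (t g' h' k' : R) : 0 <= t < 1 -> 0 < g' -> 0 < g' * k' - h' ^+ 2 ->
   4 * (kappa * (g' * k' - h' ^+ 2) ^+ 2) <= t ^+ 2 -> (g', h', k') != (g, h, k) ->
   hkPhi T D - ln q + (t - T) / (2 * S)
   - (2 + 4 * e) * ((g * k' + g' * k - 2 * h * h') / (2 * q) - 1)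
    < hkPhi t (kappa * (g' * k' - h' ^+ 2) ^+ 2) - ln (g' * k' - h' ^+ 2).
  move=> t01 g'0 q'0 d4 ne'; set q' := g' * k' - h' ^+ 2 in q'0 d4 *.
  set D' := kappa * q' ^+ 2 in d4 *.
  have D'0 : 0 <= D' by rewrite mulr_ge0// sqr_ge0.
  have := @hkPhi_tangent R T D t D' T1p D0 (andP t01).2 D'0.
  rewrite /= -/S -/P -/M.
  pose x := q' / q; pose y := (g * k' + g' * k - 2 * h * h') / (2 * q).
  have x0 : 0 < x by rewrite divr_gt0.
  have qn0 : q != 0 by rewrite gt_eqF.
  have q'E : q' = x * q by rewrite /x mulfVK.
  have D'E : D' / M = e * x ^+ 2.
    by rewrite /D' /e /D q'E; field; rewrite gt_eqF.
  have y0 : 0 < y.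
    by rewrite divr_gt0 ?mixed_disc_gt0// mulr_gt0.
  have yE : y * (2 * q) = (g * k' + g' * k - 2 * h * h').
    by rewrite mulfVK// mulf_neq0// pnatr_eq0.
  have q2 : 0 < q ^+ 2 by rewrite exprn_gt0.
  have xy : x <= y ^+ 2.
    have := @mixed_disc_le g h k g' h' k' gp qp.
    rewrite -/q -/q' -yE q'E => h2.
    by rewrite -(ler_pM2r q2); lra.
  have ne2 : (x != y ^+ 2) || (y != 1).
    rewrite -negb_and; apply: contra ne' => /andP[/eqP xE /eqP y1].
    apply/eqP; apply: (@mixed_disc_rigid g h k g' h' k') => //.
      by rewrite -/q -/q' -yE q'E xE; ring.
    by rewrite -yE y1 mul1r.
  have ex : e * x ^+ 2 <= 16^-1 by rewrite -D'E; apply: (bound t).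
  have := @ln_quad_tangent R e x y _ x0 ex y0 xy ne2.
  rewrite e0 e1 => /(_ isT).
  rewrite q'E lnM ?posrE// -/y.
  have -> : (D' - D) / M = e * (x ^+ 2 - 1).
    by rewrite mulrBl D'E /e; ring.
  by lra.
have nemid (g' h' k' g'' h'' k'' w : R) : w != 0 ->
   g = (1 - w) * g' + w * g'' -> h = (1 - w) * h' + w * h'' ->
   k = (1 - w) * k' + w * k'' -> (g', h', k') != (g'', h'', k'') ->
   (g', h', k') != (g, h, k).
  move=> w0 -> -> ->; apply: contra => /eqP[e3 e4 e5].
  have aux (u v : R) : u = (1 - w) * u + w * v -> u = v.
    by move=> uv; apply: (mulfI w0); lra.
  by rewrite (aux _ _ e3) (aux _ _ e4) (aux _ _ e5).
have n0 : (g0, h0, k0) != (g, h, k).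
  by apply: (@nemid _ _ _ g1 h1 k1 c) => //; rewrite gt_eqF.
have n1 : (g1, h1, k1) != (g, h, k).
  apply: (@nemid _ _ _ g0 h0 k0 (1 - c)); rewrite 1?eq_sym//; [rewrite lt_eqF//; lra|..]; lra.
have t0 := tang T0 g0 h0 k0 _ g0p q0p D0le n0.
have t1 := tang T1 g1 h1 k1 _ g1p q1p D1le n1.
rewrite T00 T01 in t0; have {}t0 := t0 isT.
rewrite T10 T11 in t1; have {}t1 := t1 isT.
set F0 := hkPhi T0 _ - _ in t0 *; set F1 := hkPhi T1 _ - _ in t1 *.
set F := hkPhi T _ in t0 t1 *.
have c1' : 0 < 1 - c by lra.
have := ltrD (eqbRL (ltr_pM2l c1' _ _) t0) (eqbRL (ltr_pM2l c0 _ _) t1).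
apply: le_lt_trans.
(* The mixed term is affine in the primed matrix, so its average over the endpoints is its value at
   G itself, where the quotient by 2 det G is 1. Only the trace defect, of the right sign,
   survives. *)
have -> : (1 - c) * (F - ln q + (T0 - T) / (2 * S)
   - (2 + 4 * e) * ((g * k0 + g0 * k - 2 * h * h0) / (2 * q) - 1)) +
   c * (F - ln q + (T1 - T) / (2 * S)
   - (2 + 4 * e) * ((g * k1 + g1 * k - 2 * h * h1) / (2 * q) - 1)) =
  F - ln q + ((1 - c) * T0 + c * T1 - T) / (2 * S)
   - (2 + 4 * e) * ((g * ((1 - c) * k0 + c * k1) + ((1 - c) * g0 + c * g1) * k
      - 2 * h * ((1 - c) * h0 + c * h1)) / (2 * q) - 1).
  by field; rewrite !gt_eqF//; lra.
rewrite -gE -hE -kE.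
have -> : (g * k + g * k - 2 * h * h) / (2 * q) = 1.
  by rewrite -[RHS](divff (_ : 2 * q != 0)) ?mulf_neq0 ?pnatr_eq0 ?gt_eqF// /q; congr (_ / _); ring.
rewrite subrr mulr0 subr0 lerDl divr_ge0//; lra.
Qed.

End PositiveTriples.

(** * The eigenvalues in terms of trace and determinant *)

Lemma det_mx2 (R : comNzRingType) (A : 'M[R]_2) :
  \det A = A 0 0 * A 1 1 - A 0 1 * A 1 0.
Proof.
rewrite (expand_det_row _ 0) !big_ord_recl big_ord0 /cofactor !det_mx11 !mxE /=.
rewrite /bump /= expr0 expr1 addr0 mul1r mulN1r mulrN.
by do 2?[congr (_ * _ - _ * _)]; congr (A _ _); apply: val_inj.
Qed.

Lemma mxtrace2 (R : pzSemiRingType) (A : 'M[R]_2) : \tr A = A 0 0 + A 1 1.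
Proof.
rewrite /mxtrace !big_ord_recl big_ord0 addr0.
by congr (_ + A _ _); apply: val_inj.
Qed.

Lemma mulmx2E (R : pzSemiRingType) m n (A : 'M[R]_(m, 2)) (B : 'M[R]_(2, n)) i j :
  (A *m B) i j = A i 0 * B 0 j + A i 1 * B 1 j.
Proof.
rewrite !mxE !big_ord_recl big_ord0 addr0.
by congr (_ + A _ _ * B _ _); apply: val_inj.
Qed.

Lemma ord2P (i : 'I_2) : i = 0 \/ i = 1.
Proof. by case: i => [[|[|//]] i2]; [left|right]; exact: val_inj. Qed.

(** * The quadratic form G -> Tr(A G A G): positivity and comparison with the determinant *)

Section RealForms.
Variable R : realType.
Implicit Types (a b d g h k : R) (A G : 'M[R]_2).

(* Tr(A G A G) = (Tr A G)^2 - 2 det A det G for A = (a b; b d), G = (g h; h k). *)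
Definition tr_sq a b d g h k : R :=
  (a * g + 2 * b * h + d * k) ^+ 2 - 2 * (a * d - b ^+ 2) * (g * k - h ^+ 2).

Definition mx_tr_sq A G : R :=
  tr_sq (A 0 0) (A 0 1) (A 1 1) (G 0 0) (G 0 1) (G 1 1).

(** The convexity defect of a quadratic form is its value at the difference of the endpoints. That
    difference may be indefinite, so nonnegativity is required on all symmetric matrices. *)
Lemma tr_sq_convex a b d g0 h0 k0 g1 h1 k1 c :
  tr_sq a b d ((1 - c) * g0 + c * g1) ((1 - c) * h0 + c * h1)
    ((1 - c) * k0 + c * k1) =
  (1 - c) * tr_sq a b d g0 h0 k0 + c * tr_sq a b d g1 h1 k1
  - c * (1 - c) * tr_sq a b d (g0 - g1) (h0 - h1) (k0 - k1).
Proof. by rewrite /tr_sq; ring. Qed.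

(** For A >= 0 the form is the squared norm of A^(1/2) G A^(1/2). The root is avoided by completing
    squares when a > 0; a = 0 forces b = 0. *)
Lemma psd_tr_sq_ge0 a b d g h k :
  (forall x y, 0 <= a * x ^+ 2 + 2 * b * x * y + d * y ^+ 2) ->
  0 <= tr_sq a b d g h k.
Proof.
move=> psd.
have a0 : 0 <= a by have := psd 1 0; rewrite expr1n expr0n /=; lra.
have d0 : 0 <= d by have := psd 0 1; rewrite expr1n expr0n /=; lra.
move: a0; rewrite le_eqVlt => /orP[/eqP a0|a0].
  have b0 : b = 0.
    move: d0; rewrite le_eqVlt => /orP[/eqP d0|d0].
      have := psd 1 1; have := psd 1 (- 1).
      by rewrite -a0 -d0 sqrrN expr1n; lra.
    have := psd d (- b); rewrite -a0 => h1.
    have : 0 <= d * (- b ^+ 2) by lra.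
    by rewrite pmulr_rge0// oppr_ge0 => h2; apply/eqP; rewrite -sqrf_eq0 eq_le h2 sqr_ge0.
  rewrite /tr_sq -a0 b0.
  have -> : (0 * g + 2 * 0 * h + d * k) ^+ 2 -
    2 * (0 * d - 0 ^+ 2) * (g * k - h ^+ 2) = (d * k) ^+ 2 by ring.
  exact: sqr_ge0.
have disc : 0 <= a * d - b ^+ 2.
  by rewrite -(pmulr_rge0 _ a0); have := psd (- b) a; lra.
rewrite -(pmulr_rge0 _ (exprn_gt0 2 a0)).
have -> : a ^+ 2 * tr_sq a b d g h k =
  (a ^+ 2 * g + 2 * a * b * h + b ^+ 2 * k) ^+ 2
  + 2 * (a * d - b ^+ 2) * (a * h + b * k) ^+ 2
  + ((a * d - b ^+ 2) * k) ^+ 2 by rewrite /tr_sq; ring.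
by rewrite !addr_ge0 ?sqr_ge0// mulr_ge0 ?sqr_ge0//; lra.
Qed.

Lemma quadratic_form_mx2 A (x y : R) : A^T = A ->
  (\row_j (if j == 0 then x else y) *m A *m
    (\row_j (if j == 0 then x else y))^T) 0 0 =
  A 0 0 * x ^+ 2 + 2 * A 0 1 * x * y + A 1 1 * y ^+ 2.
Proof.
move=> symA; have A01 : A 0 1 = A 1 0 by rewrite -[in LHS]symA mxE.
by rewrite !mulmx2E !mxE /= A01; ring.
Qed.

Lemma semidefinite_tr_sq_ge0 A g h k : A^T = A -> semidefinite A ->
  0 <= tr_sq (A 0 0) (A 0 1) (A 1 1) g h k.
Proof.
move=> symA [psd|nsd].
  apply: psd_tr_sq_ge0 => x y.
  by rewrite -quadratic_form_mx2.
have -> : tr_sq (A 0 0) (A 0 1) (A 1 1) g h k =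
  tr_sq (- A 0 0) (- A 0 1) (- A 1 1) g h k by rewrite /tr_sq; ring.
apply: psd_tr_sq_ge0 => x y.
have := nsd (\row_j (if j == 0 then x else y)).
by rewrite quadratic_form_mx2//; lra.
Qed.

(* [a + i a', b + i b', d + i d'] are the entries of a singular symmetric
   matrix, whose real and imaginary parts need not be semidefinite. *)
Lemma singular_tr_sq_ge0 a b d a' b' d' g h k :
  a * d - a' * d' = b ^+ 2 - b' ^+ 2 -> a * d' + a' * d = 2 * b * b' ->
  0 <= tr_sq a b d g h k + tr_sq a' b' d' g h k.
Proof.
move=> re im; pose n := a ^+ 2 + a' ^+ 2.
have n0 : 0 <= n by rewrite addr_ge0 ?sqr_ge0.
have [/eqP|nn0] := eqVneq n 0.
  rewrite /n paddr_eq0 ?sqr_ge0// !sqrf_eq0 => /andP[/eqP aE /eqP a'E].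
  rewrite aE a'E in re im *.
  have bE : b = 0.
    have [//|bn0] := eqVneq b 0.
    have : b * b' = 0 by lra.
    move/eqP; rewrite mulf_eq0 (negPf bn0)/= => /eqP b'0.
    by rewrite b'0 in re; apply/eqP; rewrite -sqrf_eq0; apply/eqP; lra.
  have b'E : b' = 0.
    by rewrite bE in re; apply/eqP; rewrite -sqrf_eq0; apply/eqP; lra.
  rewrite bE b'E /tr_sq.
  have -> : (0 * g + 2 * 0 * h + d * k) ^+ 2 -
   2 * (0 * d - 0 ^+ 2) * (g * k - h ^+ 2) +
   ((0 * g + 2 * 0 * h + d' * k) ^+ 2 -
    2 * (0 * d' - 0 ^+ 2) * (g * k - h ^+ 2)) = (d * k) ^+ 2 + (d' * k) ^+ 2.
    by ring.
  by rewrite addr_ge0 ?sqr_ge0.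
have np : 0 < n by rewrite lt0r nn0.
(* A singular symmetric matrix with nonzero corner is w w^T divided by that corner, where w is its
   first column. This gives the last entry, and [n] times the trace becomes the square of the
   Hermitian value w^* G w. *)
have dE : d = (a * (b ^+ 2 - b' ^+ 2) + a' * (2 * b * b')) / n.
  by apply: (mulIf nn0); rewrite mulfVK// -re -im /n; ring.
have d'E : d' = (a * (2 * b * b') - a' * (b ^+ 2 - b' ^+ 2)) / n.
  by apply: (mulIf nn0); rewrite mulfVK// -re -im /n; ring.
rewrite -(pmulr_rge0 _ np).
have -> : n * (tr_sq a b d g h k + tr_sq a' b' d' g h k) =
  (n * g + 2 * (a * b + a' * b') * h + (b ^+ 2 + b' ^+ 2) * k) ^+ 2.
  by rewrite dE d'E /tr_sq /n; field.
exact: sqr_ge0.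
Qed.

(* |det xi|^2 for xi = (a + i a', b + i b'; b + i b', d + i d'). *)
Definition det_normsq a b d a' b' d' : R :=
  (a * d - b ^+ 2 - (a' * d' - b' ^+ 2)) ^+ 2
  + (a * d' + a' * d - 2 * b * b') ^+ 2.

(** With G = L L^T and Y = L^T xi L, which is symmetric, xi G xibar G is similar to Y Y^*. Its
    eigenvalues are therefore real and nonnegative, and T^2 - 4 D is the square of their
    difference. *)
Lemma tr_sq_det_bound a b d a' b' d' g h k : 0 < g -> 0 < g * k - h ^+ 2 ->
  let T := tr_sq a b d g h k + tr_sq a' b' d' g h k in
  0 <= T /\
  4 * (det_normsq a b d a' b' d' * (g * k - h ^+ 2) ^+ 2) <= T ^+ 2.
Proof.
move=> g0 q0 T.
have gn0 : g != 0 by rewrite gt_eqF.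
(* The entries of L^T xi L for a triangular L with L L^T = G; the
   off-diagonal entry is divided by the square root of det G. *)
pose m1 u v w := g * u + 2 * h * v + h ^+ 2 / g * w.
pose m2 v w := v + h / g * w.
pose m3 w := (g * k - h ^+ 2) / g * w.
pose p := m1 a b d ^+ 2 + m1 a' b' d' ^+ 2.
pose r := m3 d ^+ 2 + m3 d' ^+ 2.
pose s := m2 b d ^+ 2 + m2 b' d' ^+ 2.
have TE : T = p + 2 * (g * k - h ^+ 2) * s + r.
  by rewrite /T /tr_sq /p /r /s /m1 /m2 /m3; field.
split.
  by rewrite TE !addr_ge0 ?sqr_ge0// mulr_ge0 ?addr_ge0 ?sqr_ge0//; lra.
rewrite -subr_ge0.
have -> : T ^+ 2 - 4 * (det_normsq a b d a' b' d' * (g * k - h ^+ 2) ^+ 2) =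
  (p - r) ^+ 2 + 4 * (g * k - h ^+ 2) *
   ((m1 a b d * m2 b d + m1 a' b' d' * m2 b' d'
      + (m3 d * m2 b d + m3 d' * m2 b' d')) ^+ 2
    + (m1 a' b' d' * m2 b d - m1 a b d * m2 b' d'
      + (m3 d * m2 b' d' - m3 d' * m2 b d)) ^+ 2).
  by rewrite TE /det_normsq /p /r /s /m1 /m2 /m3; field.
by rewrite addr_ge0 ?sqr_ge0// mulr_ge0 ?addr_ge0 ?sqr_ge0//; lra.
Qed.

Lemma posdef_mx2 G : posdef G ->
  [/\ G 1 0 = G 0 1, 0 < G 0 0 & 0 < G 0 0 * G 1 1 - G 0 1 ^+ 2].
Proof.
move=> [symG pos].
have posq (x y : R) : (x != 0) || (y != 0) ->
    0 < G 0 0 * x ^+ 2 + 2 * G 0 1 * x * y + G 1 1 * y ^+ 2.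
  move=> xy; rewrite -quadratic_form_mx2//; apply: pos.
  apply: contraTneq xy => /rowP v0; rewrite negb_or !negbK.
  by have := v0 0; have := v0 1; rewrite !mxE /= => -> ->; rewrite eqxx.
have g0 : 0 < G 0 0.
  by have := posq 1 0; rewrite oner_neq0 expr1n expr0n /= => /(_ isT); lra.
split=> //; first by rewrite -[in LHS]symG mxE.
rewrite -(pmulr_rgt0 _ g0).
by have := posq (- G 0 1) (G 0 0); rewrite (gt_eqF g0) orbT => /(_ isT); lra.
Qed.

End RealForms.

Definition higgs_trace (R : realType) (X : 'M[R[i]]_2) (G : 'M[R]_2) : R :=
  mx_tr_sq (mxRe X) G + mx_tr_sq (mxIm X) G.

Definition higgs_kappa (R : realType) (X : 'M[R[i]]_2) : R :=
  det_normsq (mxRe X 0 0) (mxRe X 0 1) (mxRe X 1 1)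
    (mxIm X 0 0) (mxIm X 0 1) (mxIm X 1 1).

(** The cross terms between real and imaginary parts cancel by cyclicity of the trace. *)
Lemma trace_higgs (R : realType) (X : 'M[R[i]]_2) (G : 'M[R]_2) :
  X^T = X -> G 1 0 = G 0 1 ->
  let GC := map_mx (@real_complex R) G in
  \tr (X *m GC *m map_mx (@conjc R) X *m GC) = (higgs_trace X G)%:C%C.
Proof.
move=> symX G10 /=.
have X10 : X 1 0 = X 0 1 by rewrite -[in LHS]symX mxE.
rewrite mxtrace2 !mulmx2E !mxE G10 X10.
rewrite /higgs_trace /mx_tr_sq /tr_sq !mxE.
case: (X 0 0) => a a'; case: (X 0 1) => b b'; case: (X 1 1) => d d' /=.
by simpc; congr (_ +i* _)%C; ring.
Qed.

Lemma det_higgs (R : realType) (X : 'M[R[i]]_2) (G : 'M[R]_2) :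
  X^T = X -> G 1 0 = G 0 1 ->
  let GC := map_mx (@real_complex R) G in
  \det (X *m GC *m map_mx (@conjc R) X *m GC) =
    (higgs_kappa X * (G 0 0 * G 1 1 - G 0 1 ^+ 2) ^+ 2)%:C%C.
Proof.
move=> symX G10 /=.
have X10 : X 1 0 = X 0 1 by rewrite -[in LHS]symX mxE.
rewrite !det_mulmx !det_mx2 !mxE G10 X10 /higgs_kappa /det_normsq !mxE.
case: (X 0 0) => a a'; case: (X 0 1) => b b'; case: (X 1 1) => d d' /=.
by simpc; congr (_ +i* _)%C; ring.
Qed.

(** The list of roots comes from an existence statement and has no explicit form; later arguments
    see it only through these symmetric functions, read off the coefficients of the characteristic
    polynomial. *)
Lemma eigenvals2 (R : realType) (A : 'M[R[i]]_2) :
  exists x y, [/\ eigenvals A = [:: x; y], x + y = \tr A & x * y = \det A].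
Proof.
rewrite /eigenvals; case: closed_field_poly_normal => r /= rE.
have : size r = 2%N.
  have := size_char_poly A.
  rewrite rE size_scale ?lead_coef_eq0 ?monic_neq0 ?char_poly_monic//.
  by rewrite size_prod_XsubC => -[].
move: rE; rewrite (monicP (char_poly_monic A)) scale1r.
case: r => [|x [|y [|]]]// rE _; exists x, y; split => //.
  have := @char_poly_trace _ 2 A isT; rewrite rE !big_cons big_nil mulr1.
  rewrite mulrBl coefB coefXM coefCM !coefB !coefX !coefC /= sub0r subr0 mulr1.
  by move/eqP; rewrite -opprD eqr_opp addrC => /eqP.
have := @char_poly_det _ 2 A; rewrite rE !big_cons big_nil mulr1 sqrrN expr1n mul1r.
by move=> <-; rewrite mulrBl coefB coefXM coefCM !coefB !coefX !coefC /= !sub0r mulrN opprK.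
Qed.

Lemma complex_sqr_ge0_real (R : rcfType) (z : R[i]) (t : R) :
  z ^+ 2 = t%:C%C -> 0 <= t -> complex.Im z = 0.
Proof.
case: z => p q; rewrite expr2; simpc => /= -[re im] t0.
apply/eqP; rewrite -sqrf_eq0 eq_le sqr_ge0 andbT.
have : p * q = 0 by lra.
by move=> /eqP; rewrite mulf_eq0 => /orP[] /eqP e; rewrite e in re *; lra.
Qed.

(** The square (x - y)^2 = T^2 - 4 D is real and nonnegative, so x - y is real, as is x + y.
    Nonnegative sum and product then give the signs. *)
Lemma real_roots (R : rcfType) (x y : R[i]) (T D : R) :
  x + y = T%:C%C -> x * y = D%:C%C -> 0 <= T -> 0 <= D -> 4 * D <= T ^+ 2 ->
  exists x' y', [/\ x = x'%:C%C, y = y'%:C%C, 0 <= x' /\ 0 <= y', x' + y' = T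
    & x' * y' = D].
Proof.
move=> sE pE T0 D0 disc.
have : complex.Im (x - y) = 0.
  apply: (@complex_sqr_ge0_real _ _ (T ^+ 2 - 4 * D)); last by lra.
  have -> : (x - y) ^+ 2 = (x + y) ^+ 2 - 4 * (x * y) by ring.
  by rewrite sE pE rmorphB rmorphXn rmorphM rmorph_nat.
move: x y sE pE => [x x'] [y y']; simpc => -[re im] [re2 im2] /= im3.
have x'0 : x' = 0 by lra.
have y'0 : y' = 0 by lra.
rewrite x'0 y'0 in re2 *.
have {re2} re2 : x * y = D by lra.
exists x, y; split => //; split.
- by have [//|x0] := leP 0 x; nra.
- by have [//|y0] := leP 0 y; nra.
Qed.

Lemma hk_density_value (R : realType) (A : 'M[R[i]]_2) (T D : R) :
  \tr A = T%:C%C -> \det A = D%:C%C ->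
  0 <= T < 1 -> 0 <= D -> 4 * D <= T ^+ 2 ->
  {in eigenvals A, forall delta, 0 <= delta < 1} /\
  \sum_(delta <- eigenvals A)
    (let s := Num.sqrt (1 - complex.Re delta) in 1 - s + ln ((1 + s) / 2))
  = hkPhi T D.
Proof.
move=> trA detA /andP[T0 T1] D0 disc.
have [x [y [-> xyT xyD]]] := eigenvals2 A.
rewrite trA in xyT; rewrite detA in xyD.
have [x' [y' [-> -> [x0 y0] sE pE]]] := real_roots xyT xyD T0 D0 disc.
split.
  (* Each root is at most the sum T < 1, since the other is nonnegative. *)
  by move=> z; rewrite !inE => /orP[] /eqP ->; rewrite !lecE !ltcE /= eqxx /=; lra.
rewrite big_cons big_seq1 /=.
set s := Num.sqrt (1 - x'); set t := Num.sqrt (1 - y').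
have s0 : 0 <= s by exact: sqrtr_ge0.
have t0 : 0 <= t by exact: sqrtr_ge0.
have s2 : s ^+ 2 = 1 - x' by rewrite sqr_sqrtr//; lra.
have t2 : t ^+ 2 = 1 - y' by rewrite sqr_sqrtr//; lra.
have PE : hkP T D = s * t.
  rewrite /hkP; have -> : 1 - T + D = (s * t) ^+ 2.
    by rewrite exprMn s2 t2 -sE -pE; ring.
  by rewrite sqrtr_sqr ger0_norm// mulr_ge0.
have SE : hkS T D = s + t.
  rewrite /hkS PE; have -> : 2 - T + 2 * (s * t) = (s + t) ^+ 2.
    by rewrite sqrrD s2 t2 -sE; ring.
  by rewrite sqrtr_sqr ger0_norm// addr_ge0.
rewrite /hkPhi SE PE.
(* This factorisation splits the single logarithm of [hkPhi] into one term per eigenvalue. *)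
have -> : (1 + (s + t) + s * t) / 4 = ((1 + s) / 2) * ((1 + t) / 2) by field.
have s1 : 0 < (1 + s) / 2 by lra.
have t1 : 0 < (1 + t) / 2 by lra.
by rewrite [ln (_ * ((1 + t) / 2))]lnM ?posrE//; ring.
Qed.

(** * Hessians of symplectic potentials *)

Section LineDerivatives.
Variable R : realType.
Implicit Types (f g : R * R -> R) (y v : R * R).

Lemma line_quotient f y v (t : R) :
  (fun h : R => h^-1 *: (f (y + (h *: 1 + t) *: v) - f (y + t *: v))) =
  (fun h : R => h^-1 *: (f (h *: v + (y + t *: v)) - f (y + t *: v))).
Proof.
apply/funext => h; congr (_ *: (f _ - _)).
by rewrite scalerDl /GRing.scale /= mulr1 addrCA.
Qed.

(** Transfers directional derivatives in the plane to one variable, where the calculus rules and the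
    constancy criterion apply. *)
Lemma is_derive_line f y v (t df : R) :
  is_derive (y + t *: v) v f df <->
  is_derive t 1 (fun t => f (y + t *: v)) df.
Proof.
split=> -[dbl val]; split.
- by rewrite /derivable /= line_quotient.
- by rewrite /derive /= line_quotient.
- by move: dbl; rewrite /derivable /= line_quotient.
- by move: val; rewrite /derive /= line_quotient.
Qed.

Lemma is_derive_at_line f y v (df : R) :
  is_derive (0 : R) 1 (fun t : R => f (y + t *: v)) df -> is_derive y v f df.
Proof. by move=> /is_derive_line; rewrite scale0r addr0. Qed.

Lemma constant_derivative_line f v (c : R) :
  (forall y, is_derive y v f c) ->
  forall y (t : R), f (y + t *: v) = f y + c * t.
Proof.
move=> fd y t.
have dline (s : R) : is_derive s 1 (fun t => f (y + t *: v) - c * t) 0.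
  have dl := (is_derive_line f y v s c).1 (fd _).
  by apply: is_derive_eq; rewrite /GRing.scale /= mulr1 subrr.
have := is_derive_0_is_cst t 0 dline.
by rewrite scale0r addr0 mulr0 subr0 => <-; rewrite subrK.
Qed.

Lemma derive_periodic f v w : periodic f w -> periodic (fun y => 'D_v f y) w.
Proof.
move=> per y; rewrite /derive.
suff -> : (fun h : R => h^-1 *: (f (h *: v + (y + w)) - f (y + w))) =
   (fun h : R => h^-1 *: (f (h *: v + y) - f y)) by [].
by apply/funext => h; rewrite addrA !per.
Qed.

End LineDerivatives.

(** * Smooth functions, their partial derivatives and periodicity *)

Section Smooth.
Variable R : realType.
Implicit Types (f g : R * R -> R) (y : R * R) (i j : 'I_2) (s : seq 'I_2).

Lemma smooth_partial i f : smooth f -> smooth (partial i f).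
Proof. by move=> fs s y; rewrite -foldr_rcons; exact: fs. Qed.

Lemma smooth_differentiable f y : smooth f -> differentiable f y.
Proof. by move=> fs; exact: (fs [::]). Qed.

Lemma smooth_continuous f : smooth f -> continuous f.
Proof. by move=> fs y; apply/differentiable_continuous/smooth_differentiable. Qed.

Lemma smooth_is_derive i f y : smooth f ->
  is_derive y (basis_vec R i) f (partial i f y).
Proof.
move=> fs; split=> //.
by apply/diff_derivable/smooth_differentiable.
Qed.

Lemma foldr_partial_lin (a b : R) f g s : smooth f -> smooth g ->
  foldr (@partial R) (fun y => a * f y + b * g y) s =
  (fun y => a * foldr (@partial R) f s y + b * foldr (@partial R) g s y).
Proof.
move=> fs gs; elim: s => [//|i s IH] /=; rewrite IH; apply/funext => y.
have df : is_derive y (basis_vec R i) (foldr (@partial R) f s) _ :=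
    derivableP (diff_derivable (fs s y)).
have dg : is_derive y (basis_vec R i) (foldr (@partial R) g s) _ :=
    derivableP (diff_derivable (gs s y)).
have := is_deriveD (is_deriveZ a df) (is_deriveZ b dg).
by case.
Qed.

Lemma smooth_lin (a b : R) f g : smooth f -> smooth g ->
  smooth (fun y => a * f y + b * g y).
Proof.
move=> fs gs s y; rewrite foldr_partial_lin//.
apply: differentiableD; apply: differentiableZ; [exact: fs|exact: gs].
Qed.

Lemma partial_lin (a b : R) f g i : smooth f -> smooth g ->
  partial i (fun y => a * f y + b * g y) =
  (fun y => a * partial i f y + b * partial i g y).
Proof. by move=> fs gs; exact: (@foldr_partial_lin a b f g [:: i]). Qed.

Lemma partial_periodic f i : Z2_periodic f -> Z2_periodic (partial i f).
Proof. by move=> per j; exact/derive_periodic/per. Qed.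

Lemma Z2_decomp y : y = 0 + y.1 *: basis_vec R 0 + y.2 *: basis_vec R 1.
Proof.
by case: y => a b; congr (_, _) => /=;
  rewrite /GRing.scale /= mulr1 mulr0 !add0r ?addr0.
Qed.

(** Vanishing second derivatives make the first ones constant, so f is affine; periodicity then
    forces zero slopes. *)
Lemma periodic_flat_constant f : smooth f -> Z2_periodic f ->
  (forall i j y, partial i (partial j f) y = 0) -> forall y, f y = f 0.
Proof.
move=> fs per flat.
have pcst j y : partial j f y = partial j f 0.
  have line i z t : partial j f (z + t *: basis_vec R i) = partial j f z.
    have d0 z' : is_derive z' (basis_vec R i) (partial j f) 0.
      by rewrite -(flat i j z'); exact/smooth_is_derive/smooth_partial.
    by rewrite (constant_derivative_line d0) mul0r addr0.
  by rewrite [y in LHS]Z2_decomp !line.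
have pline i z t : f (z + t *: basis_vec R i) = f z + partial i f 0 * t.
  apply: constant_derivative_line => z'.
  by rewrite -(pcst i z'); exact: smooth_is_derive.
have p0 i : partial i f 0 = 0.
  have := per i 0; rewrite -[X in f (_ + X)]scale1r pline mulr1.
  by move=> h; apply: (addrI (f 0)); rewrite addr0.
by move=> y; rewrite [y in LHS]Z2_decomp !pline !p0 !mul0r !addr0.
Qed.

End Smooth.

Section Hessian.
Variable R : realType.
Implicit Types (phi : R * R -> R) (y : R * R).

Definition half_normsq y : R := 2^-1 * (y.1 ^+ 2 + y.2 ^+ 2).

Lemma is_derive_half_normsq y i :
  is_derive y (basis_vec R i) half_normsq (if i == 0 then y.1 else y.2).
Proof.
apply: is_derive_at_line.
by rewrite /half_normsq /=; apply: is_derive_eq; rewrite /GRing.scale /=;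
  case: (ord2P i) => -> /=; field.
Qed.

Lemma is_derive_coord y i j : is_derive y (basis_vec R i)
  (fun z : R * R => if j == 0 then z.1 else z.2) (i == j)%:R.
Proof.
apply: is_derive_at_line.
by case: (ord2P i) => ->; case: (ord2P j) => -> /=; apply: is_derive_eq;
  rewrite /GRing.scale /=; field.
Qed.

Lemma hessian_half_normsqD phi y : smooth phi ->
  hessian (fun z => half_normsq z + phi z) y = 1%:M + hessian phi y.
Proof.
move=> ps; apply/matrixP => i j; rewrite !mxE.
have -> : partial j (fun z => half_normsq z + phi z) =
    (fun z => (if j == 0 then z.1 else z.2) + partial j phi z).
  apply/funext => z.
  have d1 := is_derive_half_normsq z j.
  have d2 := smooth_is_derive j z ps.
  by have := is_deriveD d1 d2; case.
have d1 := is_derive_coord y i j.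
have d2 := smooth_is_derive i y (smooth_partial j ps).
by have := is_deriveD d1 d2; case.
Qed.

Lemma hessianE u y i j : hessian u y i j = partial i (partial j u) y.
Proof. by rewrite mxE. Qed.

Lemma hessian_lin (a b : R) phi psi y i j : smooth phi -> smooth psi ->
  hessian (fun z => a * phi z + b * psi z) y i j =
    a * hessian phi y i j + b * hessian psi y i j.
Proof.
move=> ps qs; apply: etrans (hessianE _ y i j) _.
rewrite (partial_lin _ _ j ps qs).
rewrite (partial_lin _ _ i (smooth_partial j ps) (smooth_partial j qs)).
apply: esym; congr (_ * _ + _ * _).
  exact: hessianE.
exact: hessianE.
Qed.

End Hessian.

Lemma posdef_conv (R : realType) (A B : 'M[R]_2) (t : R) : 0 <= t <= 1 ->
  posdef A -> posdef B -> posdef ((1 - t) *: A + t *: B).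
Proof.
move=> /andP[t0 t1] [symA posA] [symB posB].
split; first by rewrite linearD !linearZ /= symA symB.
move=> v v0; rewrite mulmxDr mulmxDl mxE -!scalemxAr -!scalemxAl.
rewrite [X in X + _]mxE [X in _ + X]mxE.
have := posA v v0; have := posB v v0.
set a := (_ *m _ *m _) 0 0; set b := (_ *m _ *m _) 0 0 => a0 b0.
(* Strict positivity comes from the first matrix if t = 0 and from the second otherwise. *)
have [tz|tz] := eqVneq t 0; first by rewrite tz subr0 mul1r mul0r addr0.
have tp : 0 < t by rewrite lt0r tz.
by rewrite ltr_wpDl// ?mulr_gt0// mulr_ge0 ?(ltW b0)// subr_ge0.
Qed.

(** * Symplectic potentials and linear paths between them *)

Section Potentials.
Variable R : realType.
Implicit Types (u : R * R -> R) (y : R * R) (t : R) (i j : 'I_2).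

Definition potential_of (phi : R * R -> R) : R * R -> R :=
  fun y => half_normsq y + phi y.

Lemma symplectic_potential_decomp u : symplectic_potential u ->
  exists phi, [/\ smooth phi, Z2_periodic phi & u = potential_of phi].
Proof.
move=> [[phi [ps pp uE]] _]; exists phi; split => //.
by apply/funext => y; rewrite uE.
Qed.

Lemma hessian_potential phi y i j : smooth phi ->
  hessian (potential_of phi) y i j = (i == j)%:R + hessian phi y i j.
Proof. by move=> ps; rewrite hessian_half_normsqD// mxE [X in X + _]mxE. Qed.

(** The weights sum to 1, so the quadratic part is unchanged and only the periodic part moves. *)
Lemma linear_path_potential phi psi t :
  linear_path (potential_of phi) (potential_of psi) t =
  potential_of (fun y => (1 - t) * phi y + t * psi y).
Proof. by apply/funext => y; rewrite /linear_path /potential_of; ring. Qed.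

Lemma hessian_linear_path u0 u1 t y i j :
  symplectic_potential u0 -> symplectic_potential u1 ->
  hessian (linear_path u0 u1 t) y i j =
    (1 - t) * hessian u0 y i j + t * hessian u1 y i j.
Proof.
move=> /symplectic_potential_decomp[p [ps _ ->]].
move=> /symplectic_potential_decomp[q [qs _ ->]].
have shift (d a b a' b' : R) : a' = d + a -> b' = d + b ->
    d + ((1 - t) * a + t * b) = (1 - t) * a' + t * b'.
  by move=> -> ->; ring.
apply: etrans (congr1 (fun u => hessian u y i j) (linear_path_potential p q t)) _.
apply: etrans (hessian_potential _ _ _ (smooth_lin _ _ ps qs)) _.
apply: etrans (congr1 _ (hessian_lin _ _ _ _ _ ps qs)) _.
by apply: shift; exact: hessian_potential.
Qed.

Lemma hessian_continuous u i j : symplectic_potential u ->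
  continuous (fun y => hessian u y i j).
Proof.
move=> /symplectic_potential_decomp[p [ps _ ->]].
have -> : (fun y => hessian (potential_of p) y i j) =
    (fun y => (i == j)%:R + partial i (partial j p) y).
  by apply/funext => y; rewrite hessian_potential// hessianE.
move=> y; apply: cvgD; first exact: cvg_cst.
exact/smooth_continuous/smooth_partial/smooth_partial.
Qed.

Lemma hessian_periodic u : symplectic_potential u -> Z2_periodic (hessian u).
Proof.
move=> /symplectic_potential_decomp[p [ps pp ->]] k y.
apply/matrixP => i j.
have pE z : hessian (potential_of p) z i j =
    (i == j)%:R + partial i (partial j p) z.
  by rewrite hessian_potential// hessianE.
have perE := partial_periodic i (partial_periodic j pp) k y.
exact: (etrans (pE _) (etrans (congr1 (+%R (i == j)%:R) perE) (esym (pE y)))).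
Qed.

(** The difference of the potentials is smooth and periodic with zero Hessian, hence constant. In
    contrapositive form this provides a point where the Hessians differ. *)
Lemma eq_hessian_potentials u0 u1 :
  symplectic_potential u0 -> symplectic_potential u1 ->
  (forall y, hessian u0 y = hessian u1 y) ->
  exists c : R, forall y, u1 y = u0 y + c.
Proof.
move=> /symplectic_potential_decomp[p [ps pp ->]].
move=> /symplectic_potential_decomp[q [qs qp ->]] hE.
pose f y := 1 * q y + (- 1) * p y.
have fs : smooth f by exact: smooth_lin.
have fp : Z2_periodic f by move=> i y; rewrite /f pp qp.
have flat i j y : partial i (partial j f) y = 0.
  apply: etrans (esym (hessianE f y i j)) _.
  apply: etrans (hessian_lin _ _ _ _ _ qs ps) _.
  have cancel (d a b : R) : d + b = d + a -> 1 * a + -1 * b = 0.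
    by move=> /addrI ->; rewrite mul1r mulN1r subrr.
  have pE := hessian_potential y i j ps.
  have qE := hessian_potential y i j qs.
  apply: cancel; apply: etrans (esym pE) _; apply: etrans _ qE.
  exact: (congr1 (fun G : 'M[R]_2 => G i j) (hE y)).
exists (f 0) => y; rewrite -(periodic_flat_constant fs fp flat y) /f /potential_of.
by ring.
Qed.

Lemma linear_path_symplectic u0 u1 t : 0 <= t <= 1 ->
  symplectic_potential u0 -> symplectic_potential u1 ->
  symplectic_potential (linear_path u0 u1 t).
Proof.
move=> /andP[t0 t1] s0 s1; split.
  have [p [ps pp ->]] := symplectic_potential_decomp s0.
  have [q [qs qp ->]] := symplectic_potential_decomp s1.
  exists (fun y => (1 - t) * p y + t * q y); split.
  - exact: smooth_lin.
  - by move=> i y; rewrite pp qp.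
  - by move=> y; rewrite linear_path_potential.
move=> y.
have -> : hessian (linear_path u0 u1 t) y =
    (1 - t) *: hessian u0 y + t *: hessian u1 y.
  apply/matrixP => i j; rewrite hessian_linear_path// [RHS]mxE.
  by rewrite [X in _ = X + _]mxE [X in _ = _ + X]mxE.
by apply: posdef_conv; [rewrite t0|exact: s0.2|exact: s1.2].
Qed.

End Potentials.

(** * The two integrands as continuous functions on the plane *)

Section Densities.
Variable R : realType.
Implicit Types (u : R * R -> R) (y : R * R) (xi : R * R -> 'M[R[i]]_2).

Definition disc (G : 'M[R]_2) : R := G 0 0 * G 1 1 - G 0 1 ^+ 2.

Definition higgs_D (X : 'M[R[i]]_2) (G : 'M[R]_2) : R :=
  higgs_kappa X * disc G ^+ 2.

Lemma det_symmetric2 (G : 'M[R]_2) : G 1 0 = G 0 1 -> \det G = disc G.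
Proof. by move=> G10; rewrite det_mx2 G10 /disc expr2. Qed.

Lemma higgs_norm2E u xi y : higgs_tensor xi -> symplectic_potential u ->
  higgs_norm2 u xi y = (higgs_trace (xi y) (hessian u y))%:C%C.
Proof.
move=> [_ symX _] [_ /(_ y)/posdef_mx2[G10 _ _]].
by rewrite /higgs_norm2 /higgs_mx trace_higgs.
Qed.

Lemma higgs_kappa_ge0 (X : 'M[R[i]]_2) : 0 <= higgs_kappa X.
Proof. by rewrite /higgs_kappa /det_normsq addr_ge0 ?sqr_ge0. Qed.

Lemma higgs_D_ge0 (X : 'M[R[i]]_2) (G : 'M[R]_2) : 0 <= higgs_D X G.
Proof. by rewrite mulr_ge0 ?sqr_ge0// higgs_kappa_ge0. Qed.

Lemma higgs_bounds (X : 'M[R[i]]_2) (G : 'M[R]_2) : posdef G ->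
  0 <= higgs_trace X G /\ 4 * higgs_D X G <= higgs_trace X G ^+ 2.
Proof. by move=> /posdef_mx2[_ g0 q0]; exact: tr_sq_det_bound. Qed.

Lemma hk_density_phi u xi y : higgs_tensor xi -> symplectic_potential u ->
  higgs_trace (xi y) (hessian u y) < 1 ->
  {in eigenvals (higgs_mx u xi y), forall delta, 0 <= delta < 1} /\
  hk_density u xi y = hkPhi (higgs_trace (xi y) (hessian u y))
                            (higgs_D (xi y) (hessian u y)).
Proof.
move=> [_ symX _] us T1.
have pd := us.2 y; have [G10 g0 q0] := posdef_mx2 pd.
have [T0 D4] := higgs_bounds (xi y) pd.
apply: hk_density_value => //; last 2 first.
- by rewrite T0.
- exact: higgs_D_ge0.
- by rewrite trace_higgs.
- by rewrite det_higgs.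
Qed.

Lemma logdet_densityE u y : symplectic_potential u ->
  logdet_density u y = ln (disc (hessian u y)).
Proof.
by move=> [_ /(_ y)/posdef_mx2[G10 _ _]]; rewrite /logdet_density det_symmetric2.
Qed.

Lemma disc_continuous u : symplectic_potential u ->
  continuous (fun y => disc (hessian u y)).
Proof.
move=> us y; rewrite /disc.
apply: cvgB; first by apply: cvgM; exact: hessian_continuous.
by apply: cvgM; exact: hessian_continuous.
Qed.

Lemma logdet_density_continuous u : symplectic_potential u ->
  continuous (logdet_density u).
Proof.
move=> us; have -> : logdet_density u = @ln R \o (fun y => disc (hessian u y)).
  by apply/funext => y; exact: logdet_densityE.
move=> y; apply: continuous_comp; first exact: disc_continuous.
by apply: continuous_ln; have [_ _ q0] := posdef_mx2 (us.2 y).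
Qed.

Lemma cvg_sqr (f : R * R -> R) y (l : R) :
  f @ y --> l -> (fun z => f z ^+ 2) @ y --> l ^+ 2.
Proof. by move=> fl; apply: cvgM. Qed.

Lemma tr_sq_cvg (a b d g h k : R * R -> R) y (a' b' d' g' h' k' : R) :
  a @ y --> a' -> b @ y --> b' -> d @ y --> d' ->
  g @ y --> g' -> h @ y --> h' -> k @ y --> k' ->
  (fun z => tr_sq (a z) (b z) (d z) (g z) (h z) (k z)) @ y -->
    tr_sq a' b' d' g' h' k'.
Proof.
move=> ca cb cd cg ch ck; apply: cvgB.
  apply: cvg_sqr; apply: cvgD; last exact: cvgM.
  apply: cvgD; first exact: cvgM.
  by apply: cvgM => //; apply: cvgM => //; exact: cvg_cst.
apply: cvgM.
  apply: cvgM; first exact: cvg_cst.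
  by apply: cvgB; [exact: cvgM|exact: cvg_sqr].
by apply: cvgB; [exact: cvgM|exact: cvg_sqr].
Qed.

Lemma det_normsq_cvg (a b d g h k : R * R -> R) y (a' b' d' g' h' k' : R) :
  a @ y --> a' -> b @ y --> b' -> d @ y --> d' ->
  g @ y --> g' -> h @ y --> h' -> k @ y --> k' ->
  (fun z => det_normsq (a z) (b z) (d z) (g z) (h z) (k z)) @ y -->
    det_normsq a' b' d' g' h' k'.
Proof.
move=> ca cb cd cg ch ck; apply: cvgD; apply: cvg_sqr; apply: cvgB.
- by apply: cvgB; [exact: cvgM|exact: cvg_sqr].
- by apply: cvgB; [exact: cvgM|exact: cvg_sqr].
- by apply: cvgD; exact: cvgM.
- by apply: cvgM => //; apply: cvgM => //; exact: cvg_cst.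
Qed.

Lemma higgs_trace_continuous u xi : higgs_tensor xi -> symplectic_potential u ->
  continuous (fun y => higgs_trace (xi y) (hessian u y)).
Proof.
move=> [_ _ sm] us y.
have G i j : (fun z => hessian u z i j) @ y --> hessian u y i j.
  exact: hessian_continuous.
have Re i j : (fun z => mxRe (xi z) i j) @ y --> mxRe (xi y) i j.
  exact: (smooth_continuous (sm i j).1).
have Im i j : (fun z => mxIm (xi z) i j) @ y --> mxIm (xi y) i j.
  exact: (smooth_continuous (sm i j).2).
exact: cvgD (tr_sq_cvg (Re _ _) (Re _ _) (Re _ _) (G _ _) (G _ _) (G _ _))
  (tr_sq_cvg (Im _ _) (Im _ _) (Im _ _) (G _ _) (G _ _) (G _ _)).
Qed.

Lemma higgs_D_continuous u xi : higgs_tensor xi -> symplectic_potential u ->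
  continuous (fun y => higgs_D (xi y) (hessian u y)).
Proof.
move=> [_ _ sm] us y.
have Re i j : (fun z => mxRe (xi z) i j) @ y --> mxRe (xi y) i j.
  exact: (smooth_continuous (sm i j).1).
have Im i j : (fun z => mxIm (xi z) i j) @ y --> mxIm (xi y) i j.
  exact: (smooth_continuous (sm i j).2).
have Dc := cvg_sqr (@disc_continuous u us y).
exact: cvgM (det_normsq_cvg (Re _ _) (Re _ _) (Re _ _)
  (Im _ _) (Im _ _) (Im _ _)) Dc.
Qed.

Lemma hkPhi_continuous (T D : R * R -> R) y :
  {for y, continuous T} -> {for y, continuous D} -> T y < 1 ->
  {for y, continuous (fun z => hkPhi (T z) (D z))}.
Proof.
move=> Tc Dc T1.
have sq (f : R * R -> R) (l : R) : f @ y --> l ->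
    (fun z => Num.sqrt (f z)) @ y --> Num.sqrt l.
  by move=> fl; exact: (cvg_comp _ _ fl (@sqrt_continuous R l)).
have Pc : (fun z => hkP (T z) (D z)) @ y --> hkP (T y) (D y).
  by apply: (sq); apply: cvgD => //; apply: cvgB => //; exact: cvg_cst.
have Sc : (fun z => hkS (T z) (D z)) @ y --> hkS (T y) (D y).
  apply: (sq); apply: cvgD; first by apply: cvgB => //; exact: cvg_cst.
  by apply: cvgM => //; exact: cvg_cst.
apply: cvgD; first by apply: cvgB => //; exact: cvg_cst.
have Bc : (fun z => (1 + hkS (T z) (D z) + hkP (T z) (D z)) / 4) @ y -->
    (1 + hkS (T y) (D y) + hkP (T y) (D y)) / 4.
  apply: cvgM; last exact: cvg_cst.
  by apply: cvgD => //; apply: cvgD => //; exact: cvg_cst.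
apply: (cvg_comp _ _ Bc); apply: continuous_ln.
have := hkS_gt1 (D y) T1; have := hkP_ge0 (T y) (D y).
by lra.
Qed.

(** The chosen list of eigenvalues carries no continuity of its own; the expression through trace
    and determinant does. *)
Lemma hk_density_continuous u xi : higgs_tensor xi -> symplectic_potential u ->
  (forall y, higgs_trace (xi y) (hessian u y) < 1) ->
  continuous (hk_density u xi).
Proof.
move=> hx us T1.
have -> : hk_density u xi = (fun y => hkPhi (higgs_trace (xi y) (hessian u y))
                            (higgs_D (xi y) (hessian u y))).
  by apply/funext => y; have [] := hk_density_phi hx us (T1 y).
move=> y; apply: hkPhi_continuous => //.
  exact: higgs_trace_continuous.
exact: higgs_D_continuous.
Qed.

End Densities.

(** * Integration over the unit square *)

Section PlaneMeasure.
Variable R : realType.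
Implicit Types (f : R * R -> R) (U : set (R * R)).

Lemma measurable_rectangle (I J : interval R) :
  measurable ([set` I] `*` [set` J] : set (R * R)).
Proof. by apply: measurableX; exact: measurable_itv. Qed.

(** Measurability refers to the product sigma-algebra, so U is written as a countable union of open
    boxes with rational corners. *)
Lemma open_plane_measurable U : open U -> measurable U.
Proof.
rewrite openE => oU.
pose box (q : (rat * rat) * (rat * rat)) : set (R * R) :=
  `]ratr q.1.1, ratr q.1.2[ `*` `]ratr q.2.1, ratr q.2.2[.
pose F q := if pselect (box q `<=` U) then box q else set0.
have -> : U = \bigcup_q F q.
  apply/seteqP; split; last first.
    by move=> y [q _]; rewrite /F; case: pselect => //= sub; exact: sub.
  move=> y /oU/nbhs_ballP[e /= e0 ye].
  (* Balls of the product are products of balls, so one rational interval is chosen in each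
     coordinate. *)
  have split_itv (x : R) : exists2 q : rat * rat,
      x \in `]ratr q.1, ratr q.2[ &
      forall z, z \in `]ratr q.1, ratr q.2[ -> ball x e z.
    have /rat_in_itvoo[p] : x - e < x by lra.
    have /rat_in_itvoo[r] : x < x + e by lra.
    rewrite !in_itv /= => /andP[r1 r2] /andP[p1 p2]; exists (p, r) => /=.
      by rewrite in_itv /= p2 r1.
    move=> z; rewrite in_itv /= => /andP[z1 z2].
    by rewrite /ball /= ltr_norml; lra.
  have [q1 yq1 q1e] := split_itv y.1; have [q2 yq2 q2e] := split_itv y.2.
  exists (q1, q2) => //; rewrite /F; case: pselect => [sub|]; first by split.
  by case=> z [/= z1 z2]; apply: ye; split; [exact: q1e|exact: q2e].
apply: countable_bigcupT_measurable; first exact: countableP.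
move=> q; rewrite /F; case: pselect => sub /=; last exact: measurable0.
exact: measurable_rectangle.
Qed.

Lemma continuous_plane_measurable f : continuous f -> measurable_fun setT f.
Proof.
move=> /continuousP cf; apply: (measurability _ (measurable_realfun.RGenOpens.measurableE R)).
move=> _ [_ [a [b ->] <-]]; rewrite setTI.
by apply: open_plane_measurable; exact/cf/interval_open.
Qed.

Lemma mu2_rectangle (a b c d : R) : a <= b -> c <= d ->
  mu2 R (`[a, b] `*` `[c, d]) = ((b - a) * (d - c))%:E.
Proof.
have len (x y : R) : x <= y ->
    (@lebesgue_measure R `[x, y] = (y - x)%:E)%E.
  move=> xy; rewrite lebesgue_measure_itv /= lte_fin.
  by case: ltgtP xy => // ->; rewrite subrr.
move=> ab cd; rewrite /mu2 product_measure1E; [|exact: measurable_itv..].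
by rewrite [X in (X * _)%E]len// [X in (_ * X)%E]len.
Qed.

Lemma continuous_integrable_rectangle f (a b c d : R) : a <= b -> c <= d ->
  continuous f -> (mu2 R).-integrable (`[a, b] `*` `[c, d]) (EFin \o f).
Proof.
move=> ab cd cf; apply: measurable_bounded_integrable.
- exact: measurable_rectangle.
- by rewrite [X in (X < _)%E](mu2_rectangle ab cd) ltry.
- by apply: measurable_funTS; exact: continuous_plane_measurable.
- have cK : compact (`[a, b] `*` `[c, d] : set (R * R)).
    by apply: compact_setX; exact: segment_compact.
  have /compact_bounded[M [_ mrt]] :=
    continuous_compact (continuous_subspaceT cf) cK.
  by exists M; split; rewrite ?num_real // => ? ? ? ?; exact: mrt.
Qed.

Lemma continuous_integrable_square f : continuous f ->
  (mu2 R).-integrable (unit_square R) (EFin \o f).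
Proof. by move=> cf; apply: continuous_integrable_rectangle; rewrite ?ler01. Qed.

(** Near y the function exceeds f(y) / 2. As y lies in the half-open square, a small closed box with
    lower left corner y stays in the unit square and has positive area. *)
Lemma Rintegral_square_gt0 f (y : R * R) : continuous f ->
  (forall z, 0 <= f z) -> 0 <= y.1 < 1 -> 0 <= y.2 < 1 -> 0 < f y ->
  0 < \int[mu2 R]_(z in unit_square R) f z.
Proof.
move=> cf f0 /andP[y10 y11] /andP[y20 y21] fy.
have /nbhs_ballP[e /= e0 ye] : nbhs y [set z | f y / 2 < f z].
  by apply: (cvgr_gt (f y) (cf y)); lra.
(* Half of [e] keeps the closed box inside the open ball; the other two terms keep it inside the
   square. *)
pose h := Num.min (e / 2) (Num.min (1 - y.1) (1 - y.2)).
have h0 : 0 < h by rewrite !lt_min divr_gt0//= !subr_gt0 y11 y21.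
have [he h1 h2] : [/\ h <= e / 2, h <= 1 - y.1 & h <= 1 - y.2].
  by rewrite /h; split; rewrite !ge_min lexx ?orbT.
pose K : set (R * R) := `[y.1, y.1 + h] `*` `[y.2, y.2 + h].
have KU : K `<=` unit_square R.
  by move=> z [/=]; rewrite !in_itv /= => z1 z2; split; rewrite /= in_itv /=; lra.
have mK : measurable K by exact: measurable_rectangle.
have mU : measurable (unit_square R) by exact: measurable_rectangle.
have iU := continuous_integrable_square cf.
rewrite -(setDUK KU) Rintegral_setU//; [|exact: measurableD|by rewrite setDUK//|].
  apply: ltr_pwDl; last by apply: Rintegral_ge0.
  apply: (@lt_le_trans _ _ (\int[mu2 R]_(z in K) (f y / 2))).
    have muK := @mu2_rectangle y.1 (y.1 + h) y.2 (y.2 + h).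
    rewrite !lerDl (ltW h0) in muK.
    rewrite Rintegral_cst// [X in fine X](muK isT isT) /=.
    by rewrite !mulr_gt0//; lra.
  apply: le_Rintegral => //.
  - apply: continuous_integrable_rectangle; rewrite ?lerDl ?(ltW h0)//.
    exact: cst_continuous.
  - by apply: continuous_integrable_rectangle; rewrite ?lerDl ?(ltW h0).
  - move=> z [/=]; rewrite !in_itv /= => z1 z2; apply/ltW/ye.
    by split; rewrite /ball /= ltr_norml; lra.
by apply/disj_setPS => z [? []].
Qed.

End PlaneMeasure.

(** * Reduction of points of the plane to the half-open unit square *)

Lemma periodic_int (U V : zmodType) (f : U -> V) (T : U) (n : int) :
  periodic f T -> forall a, f (a + T *~ n) = f a.
Proof.
move=> per a; case: n => n; first exact: periodicn.
by rewrite NegzE mulrNz -pmulrn -(periodicn per n.+1 (a - _)) subrK.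
Qed.

Lemma Z2_periodic_reduce (R : realType) (V : zmodType) (f : R * R -> V) y :
  Z2_periodic f -> exists z, [/\ 0 <= z.1 < 1, 0 <= z.2 < 1 & f z = f y].
Proof.
move=> per; case: y => a b.
have per1 c : periodic (fun x => f (x, c)) (1 : R).
  by move=> x; rewrite -[RHS](per 0); congr (f (_, _)); rewrite /= ?addr0.
have per2 c : periodic (fun x => f (c, x)) (1 : R).
  by move=> x; rewrite -[RHS](per 1); congr (f (_, _)); rewrite /= ?addr0.
have fl (x : R) : 0 <= x + 1 *~ (- Num.floor x) < 1.
  have := floor_itv x; rewrite mulrNz rmorphD /= => /andP[].
  by rewrite -[1 *~ _]/((Num.floor x)%:~R); lra.
exists (a + 1 *~ (- Num.floor a), b + 1 *~ (- Num.floor b)); split; [exact: fl..|].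
exact: etrans (periodic_int (- Num.floor a) (per1 _) a)
  (periodic_int (- Num.floor b) (per2 a) b).
Qed.

(** * Convexity of the energy *)

Lemma hessian_linear_path_conv (R : realType) (u0 u1 : R * R -> R) (s t c : R)
    y i j : symplectic_potential u0 -> symplectic_potential u1 ->
  hessian (linear_path u0 u1 ((1 - c) * s + c * t)) y i j =
    (1 - c) * hessian (linear_path u0 u1 s) y i j
    + c * hessian (linear_path u0 u1 t) y i j.
Proof.
move=> h0 h1.
have mix (m a b p q r : R) : m = (1 - c) * s + c * t ->
    p = (1 - m) * a + m * b -> q = (1 - s) * a + s * b ->
    r = (1 - t) * a + t * b -> p = (1 - c) * q + c * r.
  by move=> -> -> -> ->; ring.
by apply: mix erefl _ _ _; exact: hessian_linear_path.
Qed.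

Lemma hessian_linear_path_inj (R : realType) (u0 u1 : R * R -> R) (s t : R) y :
  symplectic_potential u0 -> symplectic_potential u1 -> s != t ->
  hessian (linear_path u0 u1 s) y = hessian (linear_path u0 u1 t) y ->
  hessian u0 y = hessian u1 y.
Proof.
move=> h0 h1 st e; apply/matrixP => i j.
have inj (a b p q : R) : p = (1 - s) * a + s * b -> q = (1 - t) * a + t * b ->
    p = q -> a = b.
  move=> -> -> pq; apply: (mulfI (_ : s - t != 0)); first by rewrite subr_eq0.
  by lra.
apply: (inj _ _ _ _ (hessian_linear_path s y i j h0 h1)
  (hessian_linear_path t y i j h0 h1)).
exact: (congr1 (fun G : 'M[R]_2 => G i j) e).
Qed.

Section Energy.
Variable R : realType.
Implicit Types (u : R * R -> R) (y : R * R) (xi : R * R -> 'M[R[i]]_2).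

Lemma higgs_trace_lt1 u xi y : higgs_tensor xi -> symplectic_potential u ->
  higgs_norm2 u xi y < 1 -> higgs_trace (xi y) (hessian u y) < 1.
Proof. by move=> hx us; rewrite higgs_norm2E// ltcE /= => /andP[]. Qed.

Lemma conv_lt1 (a b t : R) : 0 <= t <= 1 -> a < 1 -> b < 1 ->
  (1 - t) * a + t * b < 1.
Proof.
move=> /andP[t0 t1] a1 b1.
have [->|tz] := eqVneq t 0; first by rewrite subr0 mul1r mul0r addr0.
have tp : 0 < t by rewrite lt0r tz.
have h1 : t * b < t by rewrite gtr_pMr.
have h2 : (1 - t) * a <= 1 - t by rewrite ler_piMr// ?subr_ge0// ltW.
by lra.
Qed.

Lemma higgs_trace_conv (X : 'M[R[i]]_2) (A B G : 'M[R]_2) (c : R) :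
  (forall g h k, 0 <= tr_sq (mxRe X 0 0) (mxRe X 0 1) (mxRe X 1 1) g h k
                    + tr_sq (mxIm X 0 0) (mxIm X 0 1) (mxIm X 1 1) g h k) ->
  0 <= c <= 1 -> (forall i j, G i j = (1 - c) * A i j + c * B i j) ->
  higgs_trace X G <= (1 - c) * higgs_trace X A + c * higgs_trace X B.
Proof.
move=> psd /andP[c0 c1] GE.
have h1 := psd (A 0 0 - B 0 0) (A 0 1 - B 0 1) (A 1 1 - B 1 1).
have h2 : 0 <= c * (1 - c) by rewrite mulr_ge0// subr_ge0.
have := mulr_ge0 h2 h1.
by rewrite /higgs_trace /mx_tr_sq !GE !tr_sq_convex; lra.
Qed.

(** The two alternatives on xi meet here. Semidefiniteness treats the real and imaginary parts
    separately, while a vanishing determinant controls only their sum. *)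
Lemma higgs_psd xi y : higgs_tensor xi ->
  (forall y, semidefinite (mxRe (xi y)) /\ semidefinite (mxIm (xi y))) \/
    (forall y, \det (xi y) = 0) ->
  forall g h k,
    0 <= tr_sq (mxRe (xi y) 0 0) (mxRe (xi y) 0 1) (mxRe (xi y) 1 1) g h k
       + tr_sq (mxIm (xi y) 0 0) (mxIm (xi y) 0 1) (mxIm (xi y) 1 1) g h k.
Proof.
move=> [_ symX _] [sd|sing] g h k.
  have [re im] := sd y.
  by apply: addr_ge0; apply: semidefinite_tr_sq_ge0 => //;
    rewrite /mxRe /mxIm map_trmx symX.
have X10 : xi y 1 0 = xi y 0 1 by rewrite -[in LHS]symX mxE.
have := sing y; rewrite det_mx2 X10 !mxE.
case: (xi y 0 0) => a a'; case: (xi y 0 1) => b b'; case: (xi y 1 1) => d d'.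
by simpc => -[re im]; apply: singular_tr_sq_ge0 => /=; lra.
Qed.

(** Twice the energy density. The terms are kept together because the negative slope of Phi in D is
    compensated by - ln det G. *)
Definition hk_integrand u xi y : R := hk_density u xi y - logdet_density u y.

Lemma hk_integrandE u xi y : higgs_tensor xi -> symplectic_potential u ->
  higgs_trace (xi y) (hessian u y) < 1 ->
  hk_integrand u xi y = hkPhi (higgs_trace (xi y) (hessian u y))
    (higgs_D (xi y) (hessian u y)) - ln (disc (hessian u y)).
Proof.
move=> hx us T1; rewrite /hk_integrand logdet_densityE//.
by have [_ ->] := hk_density_phi hx us T1.
Qed.

Lemma hk_matrix_lt (X : 'M[R[i]]_2) (A B G : 'M[R]_2) (c : R) :
  posdef A -> posdef B -> posdef G ->
  (forall i j, G i j = (1 - c) * A i j + c * B i j) ->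
  higgs_trace X G <= (1 - c) * higgs_trace X A + c * higgs_trace X B ->
  higgs_trace X A < 1 -> higgs_trace X B < 1 -> higgs_trace X G < 1 ->
  0 < c < 1 -> A != B ->
  hkPhi (higgs_trace X G) (higgs_D X G) - ln (disc G) <
  (1 - c) * (hkPhi (higgs_trace X A) (higgs_D X A) - ln (disc A))
  + c * (hkPhi (higgs_trace X B) (higgs_D X B) - ln (disc B)).
Proof.
move=> pA pB pG GE Tle TA TB TG c01 neq.
have [TA0 DA] := higgs_bounds X pA.
have [TB0 DB] := higgs_bounds X pB.
have [TG0 DG] := higgs_bounds X pG.
have [A10 gA qA] := posdef_mx2 pA.
have [B10 gB qB] := posdef_mx2 pB.
have [_ gG qG] := posdef_mx2 pG.
apply: hk_triple_convex => //.
- exact: higgs_kappa_ge0.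
- by rewrite TA0.
- by rewrite TB0.
- by rewrite TG0.
apply: contra neq => /eqP[e00 e01 e11]; apply/eqP/matrixP => i j.
by case: (ord2P i) => ->; case: (ord2P j) => ->; rewrite ?A10 ?B10.
Qed.

Lemma hk_integrand_lt u v w xi y (c : R) : higgs_tensor xi ->
  symplectic_potential u -> symplectic_potential v -> symplectic_potential w ->
  (forall i j, hessian w y i j = (1 - c) * hessian u y i j + c * hessian v y i j) ->
  higgs_trace (xi y) (hessian w y) <= (1 - c) * higgs_trace (xi y) (hessian u y)
    + c * higgs_trace (xi y) (hessian v y) ->
  higgs_trace (xi y) (hessian u y) < 1 -> higgs_trace (xi y) (hessian v y) < 1 ->
  higgs_trace (xi y) (hessian w y) < 1 ->
  0 < c < 1 -> hessian u y != hessian v y ->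
  hk_integrand w xi y < (1 - c) * hk_integrand u xi y + c * hk_integrand v xi y.
Proof.
move=> hx us vs ws wE Tle Tu Tv Tw c01 neq.
rewrite (hk_integrandE hx us Tu) (hk_integrandE hx vs Tv) (hk_integrandE hx ws Tw).
exact: (hk_matrix_lt (us.2 y) (vs.2 y) (ws.2 y)).
Qed.

Lemma hk_integrand_le u v w xi y (c : R) : higgs_tensor xi ->
  symplectic_potential u -> symplectic_potential v -> symplectic_potential w ->
  (forall i j, hessian w y i j = (1 - c) * hessian u y i j + c * hessian v y i j) ->
  higgs_trace (xi y) (hessian w y) <= (1 - c) * higgs_trace (xi y) (hessian u y)
    + c * higgs_trace (xi y) (hessian v y) ->
  higgs_trace (xi y) (hessian u y) < 1 -> higgs_trace (xi y) (hessian v y) < 1 ->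
  higgs_trace (xi y) (hessian w y) < 1 ->
  0 < c < 1 ->
  hk_integrand w xi y <= (1 - c) * hk_integrand u xi y + c * hk_integrand v xi y.
Proof.
move=> hx us vs ws wE Tle Tu Tv Tw c01.
(* Where the endpoint Hessians agree, so does the intermediate one, and equality holds. *)
have [uv|neq] := eqVneq (hessian u y) (hessian v y).
  have wu : hessian w y = hessian u y.
    have same (x : R) : (1 - c) * x + c * x = x by rewrite mulrBl mul1r subrK.
    apply/matrixP => i j; apply: etrans (wE i j) (etrans _ (same _)).
    exact: (congr1 (fun G : 'M[R]_2 => _ + c * G i j) (esym uv)).
  rewrite (hk_integrandE hx us Tu) (hk_integrandE hx vs Tv) (hk_integrandE hx ws Tw).
  by rewrite wu -uv mulrBl mul1r subrK.
exact/ltW/hk_integrand_lt.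
Qed.

Lemma hk_integrand_continuous u xi : higgs_tensor xi -> symplectic_potential u ->
  (forall y, higgs_trace (xi y) (hessian u y) < 1) ->
  continuous (hk_integrand u xi).
Proof.
move=> hx us T1 y; apply: cvgB; first exact: hk_density_continuous.
exact: logdet_density_continuous.
Qed.

Lemma hk_energyE u xi : higgs_tensor xi -> symplectic_potential u ->
  (forall y, higgs_trace (xi y) (hessian u y) < 1) ->
  hk_energy u xi = 2^-1 * \int[mu2 R]_(y in unit_square R) hk_integrand u xi y.
Proof.
move=> hx us T1; rewrite /hk_energy /hk_integrand RintegralB.
- by ring.
- exact: measurable_rectangle.
- exact/continuous_integrable_square/hk_density_continuous.
- exact/continuous_integrable_square/logdet_density_continuous.
Qed.

Lemma continuous_lin (f g : R * R -> R) (a b : R) :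
  continuous f -> continuous g -> continuous (fun y => a * f y + b * g y).
Proof.
move=> cf cg y; apply: cvgD; apply: cvgM; try exact: cvg_cst.
  exact: cf.
exact: cg.
Qed.

Lemma Rintegral_square_lin (f g : R * R -> R) (a b : R) :
  continuous f -> continuous g ->
  \int[mu2 R]_(y in unit_square R) (a * f y + b * g y) =
    a * \int[mu2 R]_(y in unit_square R) f y
    + b * \int[mu2 R]_(y in unit_square R) g y.
Proof.
move=> cf cg.
have mU : measurable (unit_square R) by exact: measurable_rectangle.
have sc (k : R) (h : R * R -> R) : continuous h -> continuous (fun y => k * h y).
  by move=> ch y; apply: cvgM; [exact: cvg_cst|exact: ch].
have iF := continuous_integrable_square (sc a f cf).
have iG := continuous_integrable_square (sc b g cg).
rewrite RintegralD// RintegralZl//; last exact: continuous_integrable_square.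
by rewrite RintegralZl//; exact: continuous_integrable_square.
Qed.

End Energy.

(** The energy depends on a potential only through its Hessian, so it is constant along a path that
    merely adds constants; strict convexity is therefore stated for potentials that do not differ by
    a constant. *)
Theorem theorem4p1p5 (R : realType) (xi : R * R -> 'M[R[i]]_2)
    (u0 u1 : R * R -> R)
    (hxi : higgs_tensor xi)
    (hsd : (forall y, semidefinite (mxRe (xi y)) /\
                      semidefinite (mxIm (xi y))) \/
           (forall y, \det (xi y) = 0))
    (hu0 : symplectic_potential u0) (hu1 : symplectic_potential u1)
    (hn0 : forall y, higgs_norm2 u0 xi y < 1)
    (hn1 : forall y, higgs_norm2 u1 xi y < 1) :
  (forall t : R, 0 <= t <= 1 ->
     symplectic_potential (linear_path u0 u1 t) /\
     hk_energy_defined (linear_path u0 u1 t) xi) /\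
  (~ (exists c : R, forall y, u1 y = u0 y + c) ->
   strictly_convex_on `[0, 1]
     (fun t => hk_energy (linear_path u0 u1 t) xi)).
Proof.
have psd y := higgs_psd y hxi hsd.
have T0 y := higgs_trace_lt1 hxi hu0 (hn0 y).
have T1 y := higgs_trace_lt1 hxi hu1 (hn1 y).
have path t : 0 <= t <= 1 -> symplectic_potential (linear_path u0 u1 t).
  by move=> t01; exact: linear_path_symplectic.
have Tt t y : 0 <= t <= 1 ->
    higgs_trace (xi y) (hessian (linear_path u0 u1 t) y) < 1.
  move=> t01; apply: le_lt_trans (conv_lt1 t01 (T0 y) (T1 y)).
  by apply: higgs_trace_conv => // i j; exact: hessian_linear_path.
split.
  move=> t t01; split; first exact: path.
  split.
  - by move=> y; have [] := hk_density_phi hxi (path t t01) (Tt t y t01).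
  - exact/continuous_integrable_square/logdet_density_continuous/path.
  - exact: (continuous_integrable_square
      (hk_density_continuous hxi (path t t01) (fun y => Tt t y t01))).
move=> nconst s t c; rewrite /= !in_itv /= => s01 t01 st c01.
set m := (1 - c) * s + c * t.
have m01 : 0 <= m <= 1.
  case/andP: s01 => s0 s1; case/andP: t01 => t0 t1; case/andP: c01 => c0 c1.
  have c0' := ltW c0; have c1' : 0 <= 1 - c by lra.
  apply/andP; split; first by rewrite addr_ge0// mulr_ge0.
  have h1 : (1 - c) * s <= 1 - c by rewrite ler_piMr.
  have h2 : c * t <= c by rewrite ler_piMr.
  by rewrite /m; lra.
have halve (a b e : R) : 0 < 1 * ((1 - c) * a + c * b) + (-1) * e ->
    2^-1 * e < (1 - c) * (2^-1 * a) + c * (2^-1 * b) by lra.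
have c01' : 0 <= c <= 1 by case/andP: c01 => /ltW -> /ltW ->.
have us := path s s01; have ut := path t t01; have um := path m m01.
have mE y i j : hessian (linear_path u0 u1 m) y i j =
    (1 - c) * hessian (linear_path u0 u1 s) y i j
    + c * hessian (linear_path u0 u1 t) y i j.
  exact: hessian_linear_path_conv.
have Tm y := higgs_trace_conv (psd y) c01' (mE y).
have [y0 neq0] : exists y, hessian u0 y != hessian u1 y.
  apply: contrapT => /forallNP eqH; apply: nconst.
  apply: (eq_hessian_potentials hu0 hu1) => y.
  by have /negP := eqH y; rewrite negbK => /eqP.
(* The Hessian difference is periodic, so a point where it is nonzero can be moved into [0, 1)^2, as
   [Rintegral_square_gt0] requires. *)
pose d y := hessian u0 y - hessian u1 y.
have per : Z2_periodic d.
  by move=> i y; rewrite /d (hessian_periodic hu0) (hessian_periodic hu1).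
have [y [y1 y2 dy]] := Z2_periodic_reduce y0 per.
have neq : hessian (linear_path u0 u1 s) y != hessian (linear_path u0 u1 t) y.
  apply: contra neq0 => /eqP e; rewrite -subr_eq0 -/(d y0) -dy subr_eq0.
  by apply/eqP; exact: (hessian_linear_path_inj hu0 hu1 st e).
pose F t := hk_integrand (linear_path u0 u1 t) xi.
have cF r : 0 <= r <= 1 -> continuous (F r).
  move=> r01.
  exact: (hk_integrand_continuous hxi (path r r01) (fun z => Tt r z r01)).
have eE r : 0 <= r <= 1 -> hk_energy (linear_path u0 u1 r) xi =
    2^-1 * \int[mu2 R]_(z in unit_square R) F r z.
  move=> r01.
  exact: (hk_energyE hxi (path r r01) (fun z => Tt r z r01)).
rewrite (eE m m01) (eE s s01) (eE t t01).
(* The coefficients 1 and -1 are written out so that the lemmas on linear combinations apply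
   twice. *)
pose gap z := 1 * ((1 - c) * F s z + c * F t z) + (-1) * F m z.
have cst := continuous_lin (a := 1 - c) (b := c) (cF s s01) (cF t t01).
have cgap := continuous_lin (a := 1) (b := -1) cst (cF m m01).
have : 0 < \int[mu2 R]_(z in unit_square R) gap z.
  apply: (Rintegral_square_gt0 cgap _ y1 y2).
  - move=> z; rewrite /gap mul1r mulN1r subr_ge0.
    exact: (hk_integrand_le hxi us ut um (mE z) (Tm z)
      (Tt s z s01) (Tt t z t01) (Tt m z m01) c01).
  - rewrite /gap mul1r mulN1r subr_gt0.
    exact: (hk_integrand_lt hxi us ut um (mE y) (Tm y)
      (Tt s y s01) (Tt t y t01) (Tt m y m01) c01 neq).
rewrite (Rintegral_square_lin _ _ cst (cF m m01)).
rewrite (Rintegral_square_lin _ _ (cF s s01) (cF t t01)).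
exact: halve.
Qed.
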